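(* Let $n$ be a positive integer such that the alternating group $A_n$ is simple. Then $A_n$ has exactly three supercharacter theories if and only if $n=5$ or $n=7$. Moreover, there is no simple alternating group with exactly four supercharacter theories.
   Context: For a finite group $G$, $Irr(G)$ is the set of ordinary (complex) irreducible characters of $G$ and $Con(G)$ is the set of conjugacy classes of $G$. A supercharacter theory of $G$ is a pair $(\mathcal{X},\mathcal{K})$, where $\mathcal{X}$ is a partition of $Irr(G)$ and $\mathcal{K}$ is a partition of $Con(G)$, such that (i) the identity class forms a block of $\mathcal{K}$ by itself; (ii) $|\mathcal{X}|=|\mathcal{K}|$; (iii) for each $X\in\mathcal{X}$ there is a nonzero character $\chi_X$, all of whose irreducible constituents lie in $X$, that is constant on the union of the classes in each block of $\mathcal{K}$ (equivalently, one may take $\chi_X=\sum_{\psi\in X}\psi(1)\psi$). The number of supercharacter theories of $G$ is the number of such pairs $(\mathcal{X},\mathcal{K})$. *)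

(* Defs.v *)
From mathcomp Require Import all_boot all_order all_algebra all_fingroup.
From mathcomp Require Import all_solvable all_field all_character.
From mathcomp Require Import boolp.

Set Implicit Arguments.
Unset Strict Implicit.
Unset Printing Implicit Defensive.

Import GroupScope GRing.Theory.

Section SupercharacterTheory.

Variables (gT : finGroupType) (G : {group gT}).

(* Irreducible characters are represented by their indices in Iirr G, so that *)
(* XX ranges over partitions of Irr(G); they take values in algC, which loses *)
(* nothing since complex characters of finite groups have algebraic values.   *)
(* A block of KK is a set of conjugacy classes; its cover is their union.     *)
Definition supercharacter_theory
    (T : {set {set Iirr G}} * {set {set {set gT}}}) : Prop :=
  let: (XX, KK) := T in
  [/\ partition XX [set: Iirr G] /\ partition KK (classes G),
      [set 1 ^: G] \in KK,
      #|XX| = #|KK|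
    & forall X : {set Iirr G}, X \in XX ->
      exists chi : 'CF(G),
        [/\ chi \is a character,
            chi <> 0%R,
            forall i : Iirr G, i \in irr_constt chi -> i \in X
          & forall B : {set {set gT}}, B \in KK ->
            forall x y : gT, x \in cover B -> y \in cover B -> chi x = chi y]].

(* The character chi is existentially quantified over an infinite type, so    *)
(* the predicate is made boolean classically.                                 *)
Definition supercharacter_theories :
    {set {set {set Iirr G}} * {set {set {set gT}}}} :=
  [set T | `[< supercharacter_theory T >]].

Definition num_supercharacter_theories : nat := #|supercharacter_theories|.

End SupercharacterTheory.

(* Main.v *)
(** An upper bound on the number of supercharacter theories comes from the class
algebra: the sums of psi(1) psi over the blocks of XX and the indicators of the blocks of
KK span the same space of class functions, which is closed under convolution.
Hence KK determines XX, and the number of ways to write an element as a product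
from two given blocks of KK is constant on blocks.  For A_3, A_5 and A_7, this
is tested on all partitions of the conjugacy classes, from the structure
constants obtained by enumerating the group.

Lower bounds come from orbits: automorphisms and Galois automorphisms permute
Irr(G) and the classes compatibly, and by Brauer's permutation lemma the two
orbit partitions of a cyclic group of such pairs have the same size.  If a moves
the class of x and fixes that of y, while b moves the class of y and fixes that
of x, then 1, a, b, ab give four theories, distinct from the coarsest one.
For n >= 8, x and y have distinct odd cycle lengths, so that their centralizers
in S_n are even and their S_n-classes split in A_n; a is a power map x |-> x^k
and b its product with an odd conjugation.  Conjugating a cycle to its inverse
is a reversal, whose sign is explicit, and k is chosen to be -1 or 1 modulo
each cycle length, so that the k-th power is an odd conjugate of one of x, y
and an even conjugate of the other.  For A_6, a is an odd conjugation and b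
an exotic outer automorphism. *)

Require Import Defs.
From mathcomp Require Import all_boot all_order all_algebra all_fingroup.
From mathcomp Require Import all_solvable all_field all_character.
From mathcomp Require Import boolp ring zify.

Set Implicit Arguments.
Unset Strict Implicit.
Unset Printing Implicit Defensive.

Import GroupScope GRing.Theory.
Local Open Scope ring_scope.

(** * Supercharacter theories and the class algebra *)

Section SuperclassFunctions.

Variables (gT : finGroupType) (G : {group gT}).
Implicit Types (XX : {set {set Iirr G}}) (KK : {set {set {set gT}}}).

Definition superclass_fun KK (f : 'CF(G)) :=
  forall B, B \in KK -> forall x y, x \in cover B -> y \in cover B -> f x = f y.

Definition block_char (X : {set Iirr G}) : 'CF(G) :=
  (\sum_(i in X) 'chi_i 1%g *: 'chi_i)%R.

Lemma mem_cover_classes (B : {set {set gT}}) x :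
  B \subset classes G -> (x \in cover B) = (x \in G) && (x ^: G \in B).
Proof.
move/subsetP=> sB; apply/bigcupP/andP=> [[K KB Kx] | [Gx xB]]; last first.
  by exists (x ^: G) => //; apply: class_refl.
have /imsetP[y Gy defK] := sB _ KB; rewrite {}defK in KB Kx.
by move/class_eqP: (Kx) => ->; split=> //; apply: (subsetP (class_subG Gy _)) Kx.
Qed.

Lemma cover_indicatorE (B : {set {set gT}}) x :
  B \subset classes G -> ('1_(cover B) : 'CF(G)) x = (x \in cover B)%:R.
Proof.
move=> sB; rewrite cfunElock genGid mem_cover_classes //.
suff -> : (x ^: G \subset cover B) = (x ^: G \in B) by [].
apply/subsetP/idP => [/(_ x (class_refl _ _))|xB y /class_eqP yx].
  by rewrite mem_cover_classes // => /andP[].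
have /imsetP[z Gz xz] := subsetP sB _ xB.
rewrite mem_cover_classes // yx xB andbT.
by rewrite (subsetP (class_subG Gz (subxx G))) // -xz -yx class_refl.
Qed.

Lemma cfdot_block_char (X : {set Iirr G}) i :
  '[block_char X, 'chi_i] = (('chi_i 1%g) *+ (i \in X))%R.
Proof.
rewrite cfdot_suml; have [Xi | X'i] := boolP (i \in X); last first.
  rewrite big1 // => j Xj; rewrite cfdotZl cfdot_irr.
  by case: eqP => [eji | _]; [rewrite -eji Xj in X'i | rewrite mulr0].
rewrite (bigD1 i) //= cfdotZl cfdot_irr eqxx mulr1 big1 ?addr0 // => j.
by case/andP=> _ /negPf ji; rewrite cfdotZl cfdot_irr ji mulr0.
Qed.

Section Theory.

Variables (XX : {set {set Iirr G}}) (KK : {set {set {set gT}}}).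
Hypothesis thT : supercharacter_theory (XX, KK).

(** The given characters are nonzero and pairwise orthogonal, and there are as many of them as
    blocks of [KK], so they form a basis of the superclass functions. The regular character is one
    of these functions, and comparing coefficients makes each given character proportional to the
    weighted sum [block_char X]. *)
Lemma supercharacter_theory_basis :
  (forall X, X \in XX -> superclass_fun KK (block_char X)) /\
  (forall f, superclass_fun KK f ->
     exists c : {set Iirr G} -> algC, f = (\sum_(X in XX) c X *: block_char X)%R).
Proof.
case: thT => -[pXX pKK] K1 eqXK chiP.
have sK B : B \in KK -> B \subset classes G.
  by rewrite -(cover_partition pKK) => KB; apply: bigcup_sup.
have coverP x : x \in G -> exists2 B, B \in KK & x \in cover B.
  move=> Gx; have: x ^: G \in cover KK.
    by rewrite (cover_partition pKK) mem_classes.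
  by case/bigcupP=> B KB Bx; exists B; rewrite // mem_cover_classes ?sK ?Gx.
have coverI A B x : A \in KK -> B \in KK -> x \in cover A -> x \in cover B ->
    A = B.
  move=> KA KB; rewrite !mem_cover_classes ?sK // => /andP[_ xA] /andP[_ xB].
  have tK := partition_trivIset pKK.
  by rewrite -(def_pblock tK KA xA) (def_pblock tK KB xB).
pose W := <<[seq ('1_(cover B) : 'CF(G)) | B <- enum KK]>>%VS.
have one B x : B \in KK -> ('1_(cover B) : 'CF(G)) x = (x \in cover B)%:R.
  by move/sK/cover_indicatorE.
have WP f : superclass_fun KK f -> f \in W.
  move=> sf; have -> : f = (\sum_(B <- enum KK) f (repr (cover B)) *:
      ('1_(cover B) : 'CF(G)))%R.
    apply/cfun_inP=> x Gx; have [B KB Bx] := coverP x Gx.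
    rewrite sum_cfunE big_enum /= (bigD1 B) //= cfunE one // Bx mulr1 big1.
      by rewrite addr0; apply: (sf B KB) => //; apply: mem_repr Bx.
    move=> A /andP[KA nAB]; rewrite cfunE one //.
    have [Ax|] := boolP (x \in cover A); last by rewrite mulr0.
    by rewrite (coverI A B x) ?eqxx in nAB.
  rewrite big_seq; apply: rpred_sum => B KB; apply: rpredZ.
  by apply: memv_span; apply: map_f.
(* Outside [XX] the value 0 is a dummy, which allows a choice over all subsets. *)
have /fin_all_exists[chi chiE] : forall X : {set Iirr G}, exists chi : 'CF(G),
    X \in XX -> [/\ chi != 0%R, forall i, i \notin X -> '[chi, 'chi_i] = 0%R
      & superclass_fun KK chi].
  move=> X; case: (boolP (X \in XX)) => [XX_X | _]; last by exists 0%R.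
  have [chi [_ /eqP nz sub con]] := chiP X XX_X; exists chi => _; split=> // i.
  by apply: contraNeq => nzi; apply: sub; rewrite irr_consttE.
pose S := [seq chi X | X <- enum XX].
have tXX := partition_trivIset pXX.
have chi_dot X Y : X \in XX -> Y \in XX -> X != Y -> '[chi X, chi Y] = 0.
  move=> XX_X XX_Y nXY; have [_ oX _] := chiE X XX_X.
  have [_ oY _] := chiE Y XX_Y; rewrite cfdot_sum_irr big1 // => i _.
  have [Xi | /oX->] := boolP (i \in X); last by rewrite mul0r.
  rewrite oY ?rmorph0 ?mulr0 //; apply: contraNN nXY => Yi.
  by rewrite -(def_pblock tXX XX_X Xi) (def_pblock tXX XX_Y Yi).
have oS : pairwise_orthogonal S.
  have chi_inj : {in XX &, injective chi}.
    move=> X Y XX_X XX_Y eXY; apply/eqP/negPn/negP => nXY.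
    have:= chi_dot X Y XX_X XX_Y nXY; rewrite eXY => /eqP.
    by rewrite cfnorm_eq0; have [/negPf->] := chiE Y XX_Y.
  apply/pairwise_orthogonalP; split.
    rewrite /= map_inj_in_uniq ?enum_uniq ?andbT => [|X Y]; last first.
      by rewrite !mem_enum; apply: chi_inj.
    apply/mapP=> [[X]]; rewrite mem_enum => /chiE[nz _ _] /eqP.
    by rewrite eq_sym (negPf nz).
  move=> _ _ /mapP[X + ->] /mapP[Y + ->]; rewrite !mem_enum => XX_X XX_Y nXY.
  by apply: chi_dot => //; apply: contraNneq nXY => ->.
have freeS := orthogonal_free oS.
(* Dimension count: the left side has dimension [#|XX|], the right side at most [#|KK|]. *)
have defW : (<<S>> = W)%VS.
  apply/eqP; rewrite eqEdim; apply/andP; split.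
    apply/span_subvP=> _ /mapP[X + ->]; rewrite mem_enum => XX_X.
    by apply: WP; have [] := chiE X XX_X.
  rewrite (eqnP freeS) (leq_trans (dim_span _)) // !size_map -!cardE.
  by rewrite eqXK.
have spanP f : superclass_fun KK f -> exists c : {set Iirr G} -> algC,
    f = \sum_(X in XX) c X *: chi X.
  move/WP; rewrite -defW => /(free_span freeS)[k -> _].
  by exists (fun X => k (chi X)); rewrite big_map big_enum.
have sum_dot (c : {set Iirr G} -> algC) X i : X \in XX -> i \in X ->
    '[\sum_(Y in XX) c Y *: chi Y, 'chi_i] = c X * '[chi X, 'chi_i].
  move=> XX_X Xi; rewrite cfdot_suml (bigD1 X) //= cfdotZl big1 ?addr0 // => Y.
  case/andP=> XX_Y nYX; have [_ oY _] := chiE Y XX_Y.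
  rewrite cfdotZl oY ?mulr0 //; apply: contraNN nYX => Yi.
  by rewrite -(def_pblock tXX XX_X Xi) (def_pblock tXX XX_Y Yi).
(* The regular character vanishes off the identity, whose class is a block by itself. *)
have [a reg_a] : exists a : {set Iirr G} -> algC,
    cfReg G = \sum_(X in XX) a X *: chi X.
  apply: spanP => B KB x y Bx By; rewrite !cfRegE; congr (_ *+ nat_of_bool _).
  have B1 z : z \in cover B -> z = 1%g -> B = [set (1 ^: G)%g].
    move=> Bz z1; apply: (coverI _ _ z) => //.
    by rewrite z1 /cover big_set1 class_refl.
  by apply/eqP/eqP=> z1; [move: By; rewrite (B1 _ Bx z1) | move: Bx;
    rewrite (B1 _ By z1)]; rewrite /cover big_set1 class1G => /set1P.
have aE X i : X \in XX -> i \in X -> a X * '[chi X, 'chi_i] = 'chi_i 1%g.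
  move=> XX_X Xi; rewrite -(sum_dot a X i) // -reg_a cfReg_sum cfdot_suml.
  rewrite (bigD1 i) //= cfdotZl cfdot_irr eqxx mulr1 big1 ?addr0 // => j ji.
  by rewrite cfdotZl cfdot_irr (negPf ji) mulr0.
have wE X : X \in XX -> block_char X = a X *: chi X.
  move=> XX_X; have [_ oX _] := chiE X XX_X.
  rewrite [LHS]cfun_sum_cfdot [chi X]cfun_sum_cfdot scaler_sumr.
  apply: eq_bigr => i _; rewrite scalerA cfdot_block_char; congr (_ *: _).
  by have [Xi|X'i] := boolP (i \in X); [rewrite aE | rewrite oX ?mulr0].
have a_neq0 X : X \in XX -> a X != 0.
  move=> XX_X; have /set0Pn[i Xi] := partition_neq0 pXX XX_X.
  apply: contraTneq (irr1_gt0 i) => a0.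
  by rewrite -(aE X i) // a0 mul0r Order.POrderTheory.ltxx.
split=> [X XX_X B KB x y Bx By | f /spanP[c ->]].
  have [_ _ sX] := chiE X XX_X.
  by rewrite wE // !cfunE (sX B KB x y).
exists (fun X => c X / a X); apply: eq_bigr => X XX_X.
by rewrite wE // scalerA divfK ?a_neq0.
Qed.

Lemma superclass_indicator B : B \in KK -> superclass_fun KK '1_(cover B).
Proof.
case: thT => -[_ pKK] _ _ _ KB C KC x y Cx Cy.
have sK D : D \in KK -> D \subset classes G.
  by rewrite -(cover_partition pKK) => KD; apply: bigcup_sup.
rewrite !cover_indicatorE ?sK // !mem_cover_classes ?sK //.
move: Cx Cy; rewrite !mem_cover_classes ?sK // => /andP[-> Cx] /andP[-> Cy].
have tK := partition_trivIset pKK.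
suff D z : z \in C -> (z \in B) = (B == C) by rewrite !D.
move=> Cz; apply/idP/eqP => [Bz | -> //].
by rewrite -(def_pblock tK KB Bz) (def_pblock tK KC Cz).
Qed.

(** Distinct irreducible characters convolve to 0, and ['chi_i] with itself to ['chi_i] times the
    order of [G] over its degree. The weights ['chi_i 1] cancel this denominator, so the
    [block_char X] are orthogonal idempotents up to the factor [#|G|]. *)
Lemma convolution_block_char X Y y : X \in XX -> Y \in XX -> y \in G ->
  \sum_(u in G) block_char X u * block_char Y (u^-1 * y)%g
    = (#|G|%:R * block_char X y) *+ (X == Y).
Proof.
move=> XX_X XX_Y Gy; case: thT => -[pXX _] _ _ _.
have conv_irr (i j : Iirr G) : \sum_(u in G) 'chi_i u * 'chi_j (u^-1 * y)%g
    = #|G|%:R * ('chi_i y / 'chi_i 1%g) *+ (i == j).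
  have:= generalized_orthogonality_relation y i j.
  move/(canRL (mulVKf (neq0CG G))) => orth.
  rewrite -mulrnAr -[_ *+ (i == j)]mulr_natl -orth.
  rewrite (reindex_inj (mulIg y)); apply: eq_big => [u | u Gu].
    by rewrite groupMr.
  by rewrite invMg -mulgA -conjgE cfunJ.
pose c i := 'chi[G]_i 1%g.
transitivity (\sum_(i in X) \sum_(j in Y) c i * c j *
    (\sum_(u in G) 'chi_i u * 'chi_j (u^-1 * y)%g)).
  under eq_bigr => u Gu.
    rewrite /block_char !sum_cfunE mulr_suml.
    under eq_bigr => i _. rewrite mulr_sumr cfunE.
      under eq_bigr => j _ do rewrite cfunE mulrACA.
    over. over.
  rewrite exchange_big; apply: eq_bigr => i _.
  rewrite exchange_big; apply: eq_bigr => j _.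
  by rewrite mulr_sumr.
under eq_bigr => i _ do under eq_bigr => j _ do rewrite conv_irr.
have [<- | nXY] := eqVneq X Y; last first.
  rewrite big1 // => i Xi; rewrite big1 // => j Yj.
  suff /negPf->: i != j by rewrite mulr0.
  apply: contraNneq nXY => eij; rewrite -{}eij in Yj; have tXX := partition_trivIset pXX.
  by rewrite -(def_pblock tXX XX_X Xi) (def_pblock tXX XX_Y Yj).
rewrite mulr1n /block_char sum_cfunE mulr_sumr; apply: eq_bigr => i Xi.
rewrite (bigD1 i) //= eqxx mulr1n big1 ?addr0 => [|j /andP[_ /negPf ji]].
  by rewrite cfunE /c mulrCA; field; rewrite irr1_neq0.
by rewrite eq_sym ji mulr0.
Qed.

(** The count is the convolution of two indicators. Expanded in the [block_char X], it is again a
    combination of them, hence constant on blocks. *)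
Lemma card_block_product A B C x y :
    A \in KK -> B \in KK -> C \in KK -> x \in cover C -> y \in cover C ->
  #|[set u in cover A | (u^-1 * x)%g \in cover B]|
    = #|[set u in cover A | (u^-1 * y)%g \in cover B]|.
Proof.
move=> KA KB KC Cx Cy; have [wS wB] := supercharacter_theory_basis.
have [a aE] := wB _ (superclass_indicator KA).
have [b bE] := wB _ (superclass_indicator KB).
have sK D : D \in KK -> D \subset classes G.
  case: thT => -[_ pKK] _ _ _.
  by rewrite -(cover_partition pKK) => KD; apply: bigcup_sup.
have cardE z : z \in G -> (#|[set u in cover A | (u^-1 * z)%g \in cover B]|)%:R
    = \sum_(X in XX) a X * b X * (#|G|%:R * block_char X z).
  move=> Gz; transitivity (\sum_(u in G) ('1_(cover A) : 'CF(G)) u *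
      ('1_(cover B) : 'CF(G)) (u^-1 * z)%g).
    rewrite -sum1_card natr_sum.
    under [RHS]eq_bigr => u _ do
      rewrite !cover_indicatorE ?sK // -natrM mulnb mulrb.
    rewrite -big_mkcondr; apply: eq_bigl => u; rewrite inE.
    by rewrite mem_cover_classes ?sK //; case: (u \in G).
  rewrite aE bE.
  transitivity (\sum_(X in XX) \sum_(Y in XX) a X * b Y *
      (\sum_(u in G) block_char X u * block_char Y (u^-1 * z)%g)).
    under eq_bigr => u Gu.
      rewrite !sum_cfunE mulr_suml.
      under eq_bigr => X _. rewrite mulr_sumr cfunE.
        under eq_bigr => Y _ do rewrite cfunE mulrACA.
      over. over.
    rewrite exchange_big; apply: eq_bigr => X _.
    rewrite exchange_big; apply: eq_bigr => Y _.
    by rewrite mulr_sumr.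
  apply: eq_bigr => X XX_X; rewrite (bigD1 X) //= convolution_block_char // eqxx.
  rewrite big1 ?addr0 // => Y /andP[XX_Y /negPf YX].
  by rewrite convolution_block_char // eq_sym YX mulr0.
have Gx: x \in G by move: Cx; rewrite mem_cover_classes ?sK // => /andP[].
have Gy: y \in G by move: Cy; rewrite mem_cover_classes ?sK // => /andP[].
apply/eqP; rewrite -eqC_nat; apply/eqP.
rewrite !cardE //; apply: eq_bigr => X XX_X.
by rewrite (wS X XX_X C KC x y).
Qed.

End Theory.

(** The weighted sum over a block of one partition is a superclass function, hence a combination of
    the weighted sums of the other one. So each block of the first is a union of blocks of the
    second, and conversely. *)
Lemma supercharacter_theory_inj XX XX' KK :
  supercharacter_theory (XX, KK) -> supercharacter_theory (XX', KK) -> XX = XX'.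
Proof.
have half (P Q : {set {set Iirr G}}) i j :
    supercharacter_theory (P, KK) -> supercharacter_theory (Q, KK) ->
    j \in pblock Q i -> j \in pblock P i.
  move=> thP thQ; have [wS _] := supercharacter_theory_basis thP.
  have [_ wB] := supercharacter_theory_basis thQ.
  case: (thP) (thQ) => -[pP _] _ _ _ -[[pQ _] _ _ _].
  have [tP tQ] := (partition_trivIset pP, partition_trivIset pQ).
  have inP k : k \in cover P by rewrite (cover_partition pP) inE.
  have inQ k : k \in cover Q by rewrite (cover_partition pQ) inE.
  have PX := pblock_mem (inP i); have [c cE] := wB _ (wS _ PX).
  have dot k : 'chi_k 1%g *+ (k \in pblock P i) = c (pblock Q k) * 'chi_k 1%g.
    rewrite -cfdot_block_char cE cfdot_suml (bigD1 (pblock Q k)) ?pblock_mem //=.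
    rewrite cfdotZl cfdot_block_char mem_pblock inQ mulr1n big1 ?addr0 //.
    move=> Y /andP[QY nY]; rewrite cfdotZl cfdot_block_char.
    suff /negPf-> : k \notin Y by rewrite mulr0.
    by apply: contraNN nY => Yk; rewrite (def_pblock tQ QY Yk).
  move=> Qij; have:= dot j; rewrite (same_pblock tQ Qij); have:= dot i.
  rewrite mem_pblock inP mulr1n => /eqP; rewrite eq_sym -{2}['chi_i _]mul1r.
  move/eqP/(mulIf (irr1_neq0 i)) => ->; rewrite mul1r.
  by case: (_ \in _) => // /eqP; rewrite eq_sym (negPf (irr1_neq0 j)).
move=> thP thQ; have eqB i : pblock XX i = pblock XX' i.
  by apply/setP=> j; apply/idP/idP; apply: half.
have sub (P Q : {set {set Iirr G}}) :
    partition P [set: Iirr G] -> partition Q [set: Iirr G] ->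
    pblock P =1 pblock Q -> P \subset Q.
  move=> pP pQ ePQ; apply/subsetP=> X PX.
  have /set0Pn[i Xi] := partition_neq0 pP PX.
  rewrite -(def_pblock (partition_trivIset pP) PX Xi) ePQ pblock_mem //.
  by rewrite (cover_partition pQ) inE.
case: thP thQ => -[pP _] _ _ _ -[[pQ _] _ _ _].
by apply/eqP; rewrite eqEsubset !sub // => i.
Qed.

End SuperclassFunctions.

(** * Theories from orbits *)

Section OrbitTheories.

Variables (gT : finGroupType) (G : {group gT}).

Definition sym_pair : finGroupType := ({perm Iirr G} * {perm {set gT}})%type.
Implicit Types (p q : sym_pair) (A : {group sym_pair}).

(** The order condition keeps the identity class fixed and gives all elements of a class orbit the
    same order, which tells orbit theories from the coarsest one. *)
Definition compatible p :=
  forall x, x \in G -> exists y, [/\ y \in G, p.2 (x ^: G) = y ^: G, #[x] = #[y]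
    & forall i : Iirr G, 'chi_i x = 'chi_(p.1 i) y].

Lemma compatible1 : compatible 1%g.
Proof. by move=> x Gx; exists x; split=> // [|i] /=; rewrite perm1. Qed.

Lemma compatibleM p q : compatible p -> compatible q -> compatible (p * q)%g.
Proof.
move=> cp cq x Gx; have [y [Gy py oxy chiy]] := cp x Gx.
have [z [Gz qz oyz chiz]] := cq y Gy; exists z; split; rewrite ?oxy //=.
  by rewrite permM py.
by move=> i; rewrite permM -chiz -chiy.
Qed.

Lemma compatible_cycle p : compatible p -> {in <[p]>%g, forall q, compatible q}.
Proof.
move=> cp _ /cycleP[n ->]; elim: n => [|n IHn]; first exact: compatible1.
by rewrite expgS; apply: compatibleM.
Qed.

Definition irr_act (i : Iirr G) p := p.1 i.
Definition class_act (K : {set gT}) p := p.2 K.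

Fact irr_act1 : irr_act^~ 1%g =1 id. Proof. by move=> i; apply: perm1. Qed.
Fact irr_actM i : act_morph irr_act i. Proof. by move=> p q; apply: permM. Qed.
Fact class_act1 : class_act^~ 1%g =1 id. Proof. by move=> i; apply: perm1. Qed.
Fact class_actM K : act_morph class_act K.
Proof. by move=> p q; apply: permM. Qed.

Definition irr_action := TotalAction irr_act1 irr_actM.
Definition class_action := TotalAction class_act1 class_actM.

Definition orbit_theory p :=
  (orbit irr_action <[p]> @: [set: Iirr G], orbit class_action <[p]> @: classes G).

Lemma compatible_acts p : compatible p -> [acts <[p]>, on classes G | class_action].
Proof.
move=> cp; apply/subsetP=> q pq; rewrite !inE; apply/subsetP=> _ /imsetP[x Gx ->].
have [y [Gy qy _ _]] := compatible_cycle cp pq Gx.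
by rewrite inE /= /class_act qy mem_classes.
Qed.

(** By Brauer's permutation lemma each element of the cyclic group fixes equally many characters and
    classes, so the Cauchy-Frobenius formula gives equally many orbits. The sum of the characters in
    an orbit is invariant, hence constant on class orbits. *)
Lemma orbit_theoryP p : compatible p -> supercharacter_theory (orbit_theory p).
Proof.
move=> cp; have Cp := compatible_cycle cp; have actsC := compatible_acts cp.
have actsI : [acts <[p]>, on [set: Iirr G] | irr_action].
  by apply/subsetP=> q _; rewrite !inE; apply/subsetP=> i _; rewrite !inE.
split.
- by split; apply: orbit_partition.
- apply/imsetP; exists (1 ^: G)%g; first exact: mem_classes.
  apply/esym/eqP; rewrite eqEsubset sub1set orbit_refl andbT.
  apply/subsetP=> K /orbitP[q pq <-]; rewrite inE /= /class_act.
  have [y [_ -> /eqP + _]] := Cp q pq _ (group1 G).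
  by rewrite order1 eq_sym order_eq1 => /eqP->.
- apply/eqP; rewrite -(eqn_pmul2r (cardG_gt0 <[p]>)); apply/eqP.
  rewrite -!Frobenius_Cauchy //; apply: eq_bigr => q pq; rewrite setTI.
  rewrite -(afix_ract _ (subsetT <[p]>) [set q]).
  rewrite -(afix_ract class_action (subsetT <[p]>) [set q]).
  apply: card_afix_irr_classes => //; first by rewrite acts_ract subxx.
  move=> i x y Gx.
  have [z [Gz qz _ chiz]] := Cp q pq x Gx.
  rewrite -[_ (x ^: G)%g q]/(q.2 (x ^: G)%g) qz chiz.
  by case/imsetP=> t Gt ->; rewrite cfunJ.
move=> _ /imsetP[i _ ->]; set X := orbit _ _ _.
have dotX j : '[\sum_(k in X) 'chi_k, 'chi_j] = (j \in X)%:R.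
  have [Xj | X'j] := boolP (j \in X); rewrite cfdot_suml.
    rewrite (bigD1 j) //= cfdot_irr eqxx big1 ?addr0 // => k /andP[_ /negPf kj].
    by rewrite cfdot_irr kj.
  rewrite big1 // => k Xk; rewrite cfdot_irr.
  by case: eqP Xk X'j => // -> ->.
exists (\sum_(k in X) 'chi_k); split.
- by apply: rpred_sum => k _; apply: irr_char.
- move/(congr1 (fun f => '[f, 'chi_i])); rewrite dotX cfdot0l orbit_refl.
  by move/eqP; rewrite oner_eq0.
- by move=> j; rewrite irr_consttE dotX; case: (j \in X); rewrite ?eqxx.
move=> _ /imsetP[K CK ->] x y.
have sO : orbit class_action <[p]> K \subset classes G by rewrite acts_sub_orbit.
rewrite !(mem_cover_classes _ sO) => /andP[Gx Ox] /andP[Gy].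
rewrite -(orbit_in_eqP (subsetT _) Ox) => /orbitP[q pq /= qxy].
have [z [Gz qz _ chiz]] := Cp q pq x Gx.
have chiy j : 'chi_j x = 'chi_(q.1 j) y.
  have: y \in (z ^: G)%g by rewrite -qz -[q.2 _]/(class_act _ q) qxy class_refl.
  by case/imsetP=> t Gt ->; rewrite cfunJ.
rewrite !sum_cfunE [RHS](reindex_inj (@perm_inj _ q.1)); apply: eq_big => [j|j _].
  by rewrite -[q.1 j]/(irr_action j q) orbit_actr.
by rewrite chiy.
Qed.


Lemma order_class_action p x K : compatible p -> x \in G ->
  K \in orbit class_action <[p]> (x ^: G) -> forall y, y \in K -> #[y] = #[x].
Proof.
move=> cp Gx /orbitP[q pq <-] y.
have [z [_ qz -> _]] := compatible_cycle cp pq Gx.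
by rewrite /= /class_act qz => /imsetP[t _ ->]; rewrite orderJ.
Qed.

Definition coarsest_theory : {set {set Iirr G}} * {set {set {set gT}}} :=
  ([set [set 0]; [set~ 0]], [set [set 1 ^: G]; classes G :\ (1 ^: G)])%g.

(** The second witness is the regular character minus the trivial one, equal to -1 off the identity;
    [u] makes the second blocks nonempty. *)
Lemma coarsest_theoryP u : u \in G -> u != 1%g -> supercharacter_theory coarsest_theory.
Proof.
move=> Gu u1; have uC : (u ^: G)%g \in classes G :\ (1 ^: G)%g.
  by rewrite !inE mem_classes // class1G classG_eq1 u1.
have nC : [set (1 ^: G)%g] != classes G :\ (1 ^: G)%g.
  by apply/eqP=> e; move: uC; rewrite -e !inE class1G classG_eq1 (negPf u1).
have [i0 i0P] : exists i : Iirr G, i != 0.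
  have: (1 < #|[set: Iirr G]|)%N.
    rewrite cardsT card_ord NirrE (cardsD1 (1 ^: G)%g) mem_classes //.
    by rewrite (cardD1 (u ^: G)%g) uC.
  by rewrite (cardsD1 0) inE => /card_gt0P[i /[!inE]/andP[i0 _]]; exists i.
have nI : [set (0 : Iirr G)] != [set~ 0].
  by apply/eqP=> /setP/(_ 0); rewrite !inE eqxx.
have part2 (T : finType) (a : T) (D : {set T}) :
    a \in D -> D :\ a != set0 -> partition [set [set a]; D :\ a] D.
  move=> Da D0; apply/and3P; split.
  - by rewrite /cover bigcup_setU !big_set1 setD1K.
  - apply/trivIsetP=> A B /set2P[]-> /set2P[]->; rewrite ?eqxx // => _.
      by rewrite disjoints1 !inE eqxx.
    by rewrite disjoint_sym disjoints1 !inE eqxx.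
  by rewrite !inE negb_or ![set0 == _]eq_sym D0 andbT -card_gt0 cards1.
split.
- split; last by apply: part2; [exact: mem_classes | apply/set0Pn; exists (u ^: G)%g].
  rewrite /= -setTD; apply: part2; rewrite ?inE //.
  by apply/set0Pn; exists i0; rewrite !inE i0P.
- by rewrite !inE eqxx.
- by rewrite !cards2 nI nC.
have wchar (X : {set Iirr G}) : block_char X \is a character.
  apply: rpred_sum => i _; have /Num.Theory.natrP[n ->] := Cnat_irr1 i.
  by rewrite scaler_nat rpredMn // irr_char.
have w0 (X : {set Iirr G}) i : i \in X -> block_char X <> 0.
  move=> Xi /(congr1 (fun f => '[f, 'chi_i])); rewrite cfdot_block_char Xi cfdot0l.
  by move/eqP; rewrite (negPf (irr1_neq0 i)).
have wc (X : {set Iirr G}) i : i \in irr_constt (block_char X) -> i \in X.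
  by rewrite irr_consttE cfdot_block_char; case: (i \in X); rewrite ?eqxx.
have nt B x : B \in coarsest_theory.2 -> x \in cover B -> x \in G.
  move=> KB; suff sB: B \subset classes G.
    by rewrite (mem_cover_classes _ sB) => /andP[].
  by case/set2P: KB => ->; rewrite ?subD1set // sub1set mem_classes.
have val1 x : x \in G -> block_char [set (0 : Iirr G)] x = 1.
  by move=> Gx; rewrite /block_char big_set1 irr0 cfun11 scale1r cfun1E Gx.
have reg x : x \in G -> block_char [set~ (0 : Iirr G)] x = cfReg G x - 1.
  move=> Gx; rewrite cfReg_sum (bigD1 0) //= -{1}(val1 x Gx) cfunE.
  rewrite /block_char big_set1 [X in _ = X + _ - _]/= addrAC subrr add0r.
  by congr (fun_of_cfun _ x); apply: eq_bigl => i; rewrite !inE.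
move=> X XX_X; exists (block_char X); split=> //.
- by case/set2P: XX_X => ->; [apply: (w0 _ 0) | apply: (w0 _ i0)]; rewrite !inE.
- exact: wc.
move=> B KB x y Bx By; have [Gx Gy] := (nt B x KB Bx, nt B y KB By).
case/set2P: XX_X => ->; first by rewrite !val1.
rewrite !reg // !cfRegE; suff -> : (x == 1%g) = (y == 1%g) by [].
case/set2P: KB Bx By => ->; first by rewrite /cover big_set1 class1G !inE => /eqP-> /eqP->.
have n1 z : z \in cover (classes G :\ (1 ^: G)%g) -> (z == 1%g) = false.
  rewrite (mem_cover_classes _ (subD1set _ _)) !inE class1G classG_eq1.
  by case: eqP; rewrite ?andbF.
by move=> /n1-> /n1->.
Qed.

(** In an orbit theory all elements of a block have the same order, whereas [u] and [v] share a
    block of the coarsest theory, which therefore is one more. *)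
Lemma num_supercharacter_theories_gt (ps : seq sym_pair) u v :
    {in ps, forall p, compatible p} -> uniq [seq (orbit_theory p).2 | p <- ps] ->
    u \in G -> v \in G -> u != 1%g -> v != 1%g -> #[u] <> #[v] ->
  (size ps < num_supercharacter_theories G)%N.
Proof.
move=> cps ups Gu Gv u1 v1 ouv.
have ut : uniq (coarsest_theory :: map orbit_theory ps).
  rewrite /= (@map_uniq _ _ snd) -?map_comp // andbT.
  apply/mapP=> [[p /cps cp] /(congr1 snd)/= /setP/(_ (classes G :\ (1 ^: G)%g))].
  rewrite !inE eqxx orbT => /esym/imsetP[K GK defK].
  have inD z : z \in G -> z != 1%g -> (z ^: G)%g \in orbit class_action <[p]> K.
    by move=> Gz z1; rewrite -defK !inE mem_classes // class1G classG_eq1 z1.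
  have := inD v Gv v1; rewrite -(orbit_in_eqP (subsetT _) (inD u Gu u1)).
  by move/order_class_action=> /(_ cp Gu v (class_refl _ _)) /esym.
rewrite -(size_map orbit_theory).
rewrite -[(_ < _)%N]/(size (coarsest_theory :: map orbit_theory ps) <= _)%N.
rewrite -(card_uniqP ut) /num_supercharacter_theories subset_leq_card //.
apply/subsetP=> T; rewrite !inE => /predU1P[-> | /mapP[p /cps cp ->]].
  exact/asboolP/(coarsest_theoryP Gu u1).
exact/asboolP/orbit_theoryP.
Qed.

Lemma fixed_class_orbit p x : x \in G ->
  ([set x ^: G] \in (orbit_theory p).2)%g = (p.2 (x ^: G) == x ^: G)%g.
Proof.
move=> Gx; apply/imsetP/eqP=> [[K _ defK] | fx].
  have Kx : (x ^: G)%g \in orbit class_action <[p]> K by rewrite -defK set11.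
  move: defK; rewrite -(orbit_in_eqP (subsetT _) Kx) => defK.
  have: class_action (x ^: G)%g p \in orbit class_action <[p]> (x ^: G)%g.
    by rewrite mem_orbit ?cycle_id.
  by rewrite -defK => /set1P.
exists (x ^: G)%g; first exact: mem_classes.
apply/esym/eqP; rewrite eqEsubset sub1set orbit_refl andbT.
apply/subsetP=> K /orbitP[_ /cycleP[n ->] <-]; rewrite inE; apply/eqP.
by elim: n => [|n IHn]; rewrite ?act1 // expgSr actM IHn.
Qed.

Lemma three_supercharacter_theories a x u v :
    compatible a -> x \in G -> a.2 (x ^: G)%g <> (x ^: G)%g ->
    u \in G -> v \in G -> u != 1%g -> v != 1%g -> #[u] <> #[v] ->
  (3 <= num_supercharacter_theories G)%N.
Proof.
move=> ca Gx ax Gu Gv u1 v1 ouv.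
apply: (@num_supercharacter_theories_gt [:: 1%g; a] u v) => //.
  by move=> p /[!inE]/orP[]/eqP->; first exact: compatible1.
rewrite /= !inE !andbT; apply: contra_notN ax => /eqP/esym e.
apply/eqP; rewrite -fixed_class_orbit //.
by rewrite [(_ a).2](e : _ = (orbit_theory 1%g).2) fixed_class_orbit // perm1.
Qed.

Lemma five_supercharacter_theories a b x y u v :
    compatible a -> compatible b -> x \in G -> y \in G ->
    a.2 (x ^: G)%g <> (x ^: G)%g -> a.2 (y ^: G)%g = (y ^: G)%g ->
    b.2 (y ^: G)%g <> (y ^: G)%g -> b.2 (x ^: G)%g = (x ^: G)%g ->
    u \in G -> v \in G -> u != 1%g -> v != 1%g -> #[u] <> #[v] ->
  (5 <= num_supercharacter_theories G)%N.
Proof.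
move=> ca cb Gx Gy ax ay b_y bx Gu Gv u1 v1 ouv.
apply: (@num_supercharacter_theories_gt [:: 1; a; b; a * b]%g u v) => //.
  move=> p /[!inE]/or4P[]/eqP-> //; first exact: compatible1.
  exact: compatibleM.
(* Whether the classes of [x] and of [y] are blocks by themselves: the four pairs of answers occur
   for 1, [a], [b] and [a * b]. *)
pose f (K : {set {set {set gT}}}) := ([set x ^: G] \in K, [set y ^: G] \in K)%g.
suff: uniq (map f [seq (orbit_theory p).2 | p <- [:: 1; a; b; a * b]%g]).
  exact: map_uniq.
rewrite -map_comp /= /f !fixed_class_orbit //= !permM !perm1 !eqxx.
have -> : (a.2 (x ^: G) == x ^: G)%g = false by apply/eqP.
have -> : (b.2 (y ^: G) == y ^: G)%g = false by apply/eqP.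
have -> : (b.2 (a.2 (x ^: G)) == x ^: G)%g = false.
  by apply/eqP; rewrite -{2}bx => /perm_inj.
rewrite ay bx !eqxx.
have -> : (b.2 (y ^: G) == y ^: G)%g = false by apply/eqP.
by [].
Qed.

End OrbitTheories.

(** * Compatible pairs from group and Galois automorphisms *)

Section CompatiblePairs.

Variables (gT : finGroupType) (G : {group gT}).

Lemma compatible_of_map (s : Iirr G -> Iirr G) (f : gT -> gT) :
    injective s -> {in G, forall x, f x \in G} ->
    {in G &, forall x y, (f x \in (f y) ^: G) = (x \in y ^: G)} ->
    {in G, forall x, #[f x] = #[x]} ->
    (forall i x, x \in G -> 'chi_i x = 'chi_(s i) (f x)) ->
  exists2 p : sym_pair G, compatible p
    & {in G, forall x, p.2 (x ^: G)%g = (f x ^: G)%g}.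
Proof.
move=> injs Gf clf of_ chif.
(* Sets that are not classes are left in place, so that [F] permutes all sets. *)
pose F (K : {set gT}) := if K \in classes G then (f (repr K) ^: G)%g else K.
have FE x : x \in G -> F (x ^: G)%g = (f x ^: G)%g.
  move=> Gx; rewrite /F mem_classes //; apply/class_eqP.
  have xr : repr (x ^: G)%g \in (x ^: G)%g by apply: mem_repr (class_refl _ _).
  by rewrite clf // (subsetP (class_subG Gx (subxx G))).
have injF : injective F.
  have FC K : K \in classes G -> F K \in classes G.
    by case/imsetP=> x Gx ->; rewrite FE // mem_classes ?Gf.
  move=> K L; have [CK | nK] := boolP (K \in classes G).
    have [CL | nL] := boolP (L \in classes G); last first.
      by move: (FC K CK) => + e; rewrite e /F (negPf nL) (negPf nL).
    case/imsetP: CK CL => x Gx -> /imsetP[y Gy ->]; rewrite !FE // => /class_eqP.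
    by rewrite clf // => /class_eqP.
  have [CL | nL] := boolP (L \in classes G).
    by move: (FC L CL) => + e; rewrite -e /F (negPf nK) (negPf nK).
  by rewrite /F (negPf nK) (negPf nL).
exists (perm injs, perm injF) => [x Gx | x Gx /=]; last by rewrite permE FE.
by exists (f x); split; rewrite ?Gf ?of_ //= ?permE ?FE // => i; rewrite permE chif.
Qed.

Lemma compatible_automorphism (f : {morphism G >-> gT}) :
    'injm f -> f @* G = G ->
  exists2 p : sym_pair G, compatible p
    & {in G, forall x, p.2 (x ^: G)%g = (f x ^: G)%g}.
Proof.
move=> injf fG; have isof : isom G G f by apply/isomP.
apply: (compatible_of_map (s := isom_Iirr isof)) => [|x Gx|x y Gx Gy|x Gx|i x Gx].
- exact: isom_Iirr_inj.
- by rewrite -{2}fG mem_morphim.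
- apply/imsetP/imsetP => [[t Gt fxy] | [z Gz ->]]; last first.
    by exists (f z); rewrite -?morphJ // -{2}fG mem_morphim.
  have /morphimP[z _ Gz tz] : t \in f @* G by rewrite fG.
  by exists z => //; apply: (injmP injf); rewrite ?groupJ // morphJ -?tz.
- by rewrite order_injm.
by rewrite isom_IirrE cfIsomE.
Qed.

(** A field automorphism raising the [#|G|]-th roots of unity to the power [k] turns the value of a
    character at [x] into its value at [x ^+ k]. *)
Lemma compatible_power k : coprime #|G| k ->
  exists2 p : sym_pair G, compatible p
    & {in G, forall x, p.2 (x ^: G)%g = ((x ^+ k) ^: G)%g}.
Proof.
move=> coGk; have [u uE] : {u : {rmorphism algC -> algC} |
    forall z, z ^+ #|G| = 1 -> u z = z ^+ k}.
  by apply: Qn_aut_exists; rewrite coprime_sym.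
have chiu i x : x \in G -> 'chi_(aut_Iirr u i) x = 'chi[G]_i (x ^+ k)%g.
  move=> Gx; have sxG : <[x]>%g \subset G by rewrite cycle_subG.
  have Xx := cycle_id x; rewrite aut_IirrE cfunE.
  rewrite -!(cfResE _ sxG) ?mem_cycle //.
  (* On the cyclic group of [x] the character is a sum of linear ones, whose values are roots of
     unity. *)
  have /char_sum_irr[r ->] := cfRes_char <[x]> (irr_char i).
  rewrite !sum_cfunE rmorph_sum; apply: eq_bigr => j _.
  have lin_j := irr_cyclic_lin j (cycle_cyclic x).
  rewrite lin_charX // uE // -(lin_charX lin_j) //.
  by rewrite (eqP (_ : x ^+ #|G| == 1)%g) ?lin_char1 // -order_dvdn order_dvdG.
have injk := can_in_inj (expgK coGk).
(* The inverse appears because it is the value at [x ^+ k] of the new character that must equal the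
   value at [x] of the old one. *)
apply: (compatible_of_map (s := ((perm (@aut_Iirr_inj _ G u))^-1)%g)).
- exact: perm_inj.
- by move=> x Gx; rewrite groupX.
- move=> x y Gx Gy; apply/imsetP/imsetP => -[z Gz]; rewrite ?conjXg => e.
    by exists z => //; apply: injk; rewrite ?groupJ.
  by exists z; rewrite ?conjXg ?e.
- by move=> x Gx; rewrite orderXgcd (eqP (coprime_dvdl (order_dvdG Gx) coGk)) divn1.
move=> i x Gx; rewrite -chiu // -(permE (@aut_Iirr_inj _ G u)).
by rewrite permKV.
Qed.

End CompatiblePairs.

Local Close Scope ring_scope.

(** * Permutations with cycles of distinct odd lengths *)

Lemma odd_permX (T : finType) (h : {perm T}) j : odd_perm (h ^+ j) = odd j && odd_perm h.
Proof.
elim: j => [|j IHj]; first by rewrite odd_perm1.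
by rewrite expgS odd_permM IHj /=; case: (odd j) (odd_perm h) => -[].
Qed.

(* An element commuting with g preserves the cycle lengths d, hence acts on   *)
(* each cycle of g as a power of g, and so has odd order.                     *)
Lemma commute_odd_cycles (T : finType) (g h : {perm T}) (d : T -> nat) :
    (forall x j, ((g ^+ j) x == x) = (d x %| j)) -> (forall x, odd (d x)) ->
    (forall x y, d x = d y -> exists j, y = (g ^+ j) x) ->
  commute g h -> odd_perm h = false.
Proof.
move=> dP oddd same cgh.
have hg j x : h ((g ^+ j) x) = (g ^+ j) (h x).
  by rewrite -!permM (commuteX j (commute_sym cgh)).
have dh x : d (h x) = d x.
  apply/eqP; rewrite eqn_dvd; apply/andP; split; rewrite -dP.
    by rewrite -hg (inj_eq perm_inj) dP.
  by rewrite -(inj_eq (@perm_inj _ h)) hg dP.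
pose N := (\prod_(x : T) d x)%N.
have oddN : odd N.
  by rewrite /N; elim/big_rec: _ => // x v _ ov; rewrite oddM oddd.
have hN : h ^+ N = 1.
  apply/permP=> x; rewrite perm1; have [a ha] := same _ _ (esym (dh x)).
  have -> : (h ^+ N) x = (g ^+ (a * N)) x.
    elim: (N) => [|j IHj]; first by rewrite muln0.
    by rewrite expgSr permM IHj hg ha -permM -expgD mulnS.
  by apply/eqP; rewrite dP dvdn_mull // /N (bigD1 x) //= dvdn_mulr.
by have := odd_permX h N; rewrite hN odd_perm1 oddN.
Qed.

(** If [g ^ h = g ^ z] with [z] even, then [h * z^-1] centralizes [g], so it is even and so is
    [h]. *)
Lemma conj_Alt_class n (g h : {perm 'I_n}) :
    (forall z, commute g z -> odd_perm z = false) ->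
  (g ^ h \in g ^: 'Alt_('I_n)) = ~~ odd_perm h.
Proof.
move=> cent; apply/imsetP/idP=> [[z] | even_h]; last by exists h; rewrite ?Alt_even.
rewrite Alt_even => even_z ghz.
have: commute g (h * z^-1).
  by apply/commgP/conjg_fixP; rewrite conjgM ghz conjgK.
by move/cent; rewrite odd_permM odd_permV (negPf even_z) addbF => ->.
Qed.

(** Start and length of the interval containing [x], when consecutive intervals of lengths [s] are
    laid out from 0; the length is 0 beyond them. *)
Fixpoint block (s : seq nat) x : nat * nat :=
  if s is m :: s' then
    if x < m then (0, m) else let: (a, l) := block s' (x - m) in (m + a, l)
  else (0, 0).

Lemma blockP s x : x < sumn s ->
  [/\ (block s x).1 <= x, x < (block s x).1 + (block s x).2,
      (block s x).1 + (block s x).2 <= sumn s & (block s x).2 \in s].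
Proof.
elim: s x => //= m s IHs x ltx; case: ltnP => /= [ltxm | lemx].
  by split; rewrite ?mem_head ?add0n ?leq_addr.
have ltx' : x - m < sumn s by lia.
case: (block s (x - m)) (IHs _ ltx') => a l /= [h1 h2 h3 h4].
by rewrite inE h4 orbT; split=> //; lia.
Qed.

Lemma block_same s x y : x < sumn s ->
    (block s x).1 <= y < (block s x).1 + (block s x).2 -> block s y = block s x.
Proof.
elim: s x y => //= m s IHs x y ltx; case: ltnP => /= [ltxm | lemx].
  by rewrite add0n => ->.
have ltx' : x - m < sumn s by lia.
have := IHs (x - m) (y - m) ltx'; have [+ _ _ _] := blockP ltx'.
case: (block s (x - m)) => a l /= h1 IH ay.
have -> : (y < m) = false by lia.
by rewrite IH //; lia.
Qed.

Lemma block_inj s x y : uniq s -> x < sumn s -> y < sumn s ->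
  (block s x).2 = (block s y).2 -> block s x = block s y.
Proof.
elim: s x y => //= m s IHs x y /andP[nms us] ltx lty.
have out z : z - m < sumn s -> (block s (z - m)).2 <> m.
  by move/blockP=> [_ _ _] + em; rewrite em (negPf nms).
case: ltnP => [ltxm | lemx]; case: ltnP => [ltym | lemy] //=.
- have /out : y - m < sumn s by lia.
  by case: (block s (y - m)) => a l /= nl el; case: nl.
- have /out : x - m < sumn s by lia.
  by case: (block s (x - m)) => a l.
have ltx' : x - m < sumn s by lia.
have lty' : y - m < sumn s by lia.
have := IHs _ _ us ltx' lty'.
case: (block s (x - m)) (block s (y - m)) => a l [a' l'] /= IH el.
by have [-> ->] := IH el.
Qed.

(** Below [sumn s] this is a permutation whose cycles are the blocks. *)
Definition rotate s x := (block s x).1 + (x - (block s x).1).+1 %% (block s x).2.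

Lemma iter_rotate s x j : x < sumn s ->
  iter j (rotate s) x = (block s x).1 + (x - (block s x).1 + j) %% (block s x).2.
Proof.
move=> ltx; have [h1 h2 h3 _] := blockP ltx.
elim: j => [|j IHj]; first by rewrite addn0 modn_small //=; lia.
have l_gt0 : 0 < (block s x).2 by lia.
rewrite iterS IHj {1}/rotate (@block_same s x) // ?leq_addr ?ltn_add2l ?ltn_mod //.
by rewrite addKn -addn1 modnDml addn1 addnS.
Qed.

Lemma block_rotate s x : x < sumn s -> block s (rotate s x) = block s x.
Proof.
move=> ltx; have [h1 h2 _ _] := blockP ltx; apply: block_same => //.
by rewrite /rotate leq_addr ltn_add2l ltn_mod; lia.
Qed.

Lemma rotate_lt s x : x < sumn s -> rotate s x < sumn s.
Proof.
move=> ltx; have [h1 h2 h3 _] := blockP ltx; rewrite /rotate.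
by have := ltn_pmod (x - (block s x).1).+1 (_ : 0 < (block s x).2); lia.
Qed.

Lemma perm_of_nat n (F : nat -> nat) :
    (forall x, x < n -> F x < n) ->
    (forall x y, x < n -> y < n -> F x = F y -> x = y) ->
  exists p : {perm 'I_n}, forall i, p i = F i :> nat.
Proof.
move=> ltF injF; pose f (i : 'I_n) := Ordinal (ltF i (ltn_ord i)).
have inj_f : injective f.
  by move=> i j /(congr1 val)/= e; apply/val_inj/(injF _ _ (ltn_ord i) (ltn_ord j)).
by exists (perm inj_f) => i; rewrite permE.
Qed.

(** Exchanging the two end points and recursing inside uses [m./2] transpositions. *)
Lemma reversal_perm n a m : a + m <= n ->
  exists2 p : {perm 'I_n}, odd_perm p = odd m./2 &
    forall i : 'I_n, p i = (if a <= i < a + m then a + (a + m) - i.+1 else i) :> nat.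
Proof.
elim/ltn_ind: m a => -[|[|m]] IHm a leamn.
- by exists 1 => [|i]; rewrite ?odd_perm1 // perm1; case: ifP => //; lia.
- by exists 1 => [|i]; rewrite ?odd_perm1 // perm1; case: ifP => //; lia.
have [||p oddp pE] := IHm m _ a.+1; [by [] | lia |].
have [lta ltb] : a < n /\ a + m.+1 < n by lia.
exists (tperm (Ordinal lta) (Ordinal ltb) * p) => [|i].
  rewrite odd_permM odd_tperm oddp /= -val_eqE /=.
  by have -> : a != a + m.+1 by lia.
rewrite permM pE; case: tpermP => [->|->|] /=.
- by do ?case: ifP => ?; lia.
- by do ?case: ifP => ?; lia.
move=> /eqP; rewrite -val_eqE /= => ia /eqP; rewrite -val_eqE /= => ib.
by do ?case: ifP => ?; lia.
Qed.

(** Reflects each block whose length satisfies [e], which conjugates the rotation of that block to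
    its inverse. *)
Definition flip (e : pred nat) s x :=
  if e (block s x).2 then 2 * (block s x).1 + (block s x).2 - x.+1 else x.

(** The offset [a] lets blocks be treated one at a time; the parities of their reversals add up. *)
Lemma flip_perm n (e : pred nat) s a : a + sumn s <= n ->
  exists2 p : {perm 'I_n},
    odd_perm p = odd (sumn [seq if e m then m./2 else 0 | m <- s]) &
    forall i : 'I_n,
      p i = (if a <= i < a + sumn s then a + flip e s (i - a) else i) :> nat.
Proof.
elim: s a => [|m s IHs] a /= le_n.
  by exists 1 => [|i]; rewrite ?odd_perm1 // perm1; case: ifP => //; lia.
have [|p oddp pE] := IHs (a + m); first by lia.
have [q oddq qE] : exists2 q : {perm 'I_n}, odd_perm q = odd (if e m then m./2 else 0) &
    forall i : 'I_n, q i =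
      (if (a <= i < a + m) && e m then a + (a + m) - i.+1 else i) :> nat.
  case: (e m); last by exists 1 => [|i]; rewrite ?odd_perm1 ?perm1 ?andbF.
  have [|q oddq qE] := @reversal_perm n a m; first by lia.
  by exists q => // i; rewrite andbT.
exists (q * p) => [|i]; first by rewrite odd_permM oddD oddp oddq.
rewrite permM pE qE /flip /=.
have [in1 | out1] := boolP (a <= i < a + m).
  have -> : i - a < m by lia.
  by rewrite /=; case: (e m) => /=; do ?case: ifP => ?; lia.
rewrite /=; have [in2 | out2] := boolP (a + m <= i < a + m + sumn s); last first.
  by case: ifP => //; lia.
have -> : (a <= i < a + (m + sumn s)) by lia.
have -> : (i - a < m) = false by lia.
have -> : i - a - m = i - (a + m) by lia.
have [] := @blockP s (i - (a + m)); first by lia.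
case: (block s _) => b l /= *.
by case: ifP; lia.
Qed.

(** Here [g] rotates all blocks and [h] reverses those selected by [e]. Conjugation by [h] inverts
    the selected cycles and keeps the others; this is the power [k], which is -1 (written [m.-1]) or
    1 modulo the lengths. *)
Lemma block_cycles n s (e : pred nat) k :
    sumn s = n -> uniq s -> all odd s ->
    {in s, forall m, k = (if e m then m.-1 else 1)%N %[mod m]} ->
  exists g h : {perm 'I_n},
    [/\ forall z, commute g z -> odd_perm z = false, g ^ h = g ^+ k
      & odd_perm h = odd (sumn [seq if e m then m./2 else 0 | m <- s])].
Proof.
move=> sn us odds ks.
have bP (i : 'I_n) : i < sumn s by rewrite sn.
have [||g gE] := @perm_of_nat n (rotate s).
- by rewrite -sn; apply: rotate_lt.
- rewrite -sn => x y ltx lty e_xy.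
  have eb : block s x = block s y.
    by rewrite -(block_rotate ltx) e_xy block_rotate.
  have l_gt0 : 0 < (block s x).2 by have [] := blockP ltx; lia.
  (* A full turn of a block is the identity, so [rotate] is injective. *)
  have := iter_rotate (block s x).2 ltx; have := iter_rotate (block s y).2 lty.
  rewrite -eb !modnDr -(prednK l_gt0) !iterSr e_xy => ->.
  have [h1 h2 h3 _] := blockP ltx; have [h1' h2' h3' _] := blockP lty.
  by rewrite -eb in h1' h2' *; rewrite prednK // !modn_small; lia.
have gX j i : (g ^+ j) i = iter j (rotate s) i :> nat.
  elim: j => [|j IHj]; first by rewrite perm1.
  by rewrite expgSr permM gE IHj.
have [h oddh hE] := @flip_perm n e s 0 (eq_leq sn).
exists g, h; split=> // [z|].
  apply: (@commute_odd_cycles _ _ _ (fun i : 'I_n => (block s i).2)) => [x j|x|x y el].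
  - have [h1 h2 h3 _] := blockP (bP x).
    rewrite -val_eqE /= gX iter_rotate //.
    rewrite -[X in _ == X](subnKC h1) eqn_add2l.
    have lt_l : x - (block s x).1 < (block s x).2 by lia.
    by rewrite -[X in _ == X](modn_small lt_l) -[X in _ == X %% _]addn0 eqn_modDl mod0n.
  - by apply: (allP odds); have [] := blockP (bP x).
  have eb : block s x = block s y by apply: block_inj.
  have [h1 h2 h3 _] := blockP (bP x); have [h1' h2' h3' _] := blockP (bP y).
  (* The added block length keeps the truncated subtraction exact. *)
  exists (y + (block s x).2 - x); apply: val_inj; rewrite /= gX iter_rotate //.
  have -> : x - (block s x).1 + (y + (block s x).2 - x)
      = y - (block s y).1 + (block s x).2 by rewrite -eb in h1' h2' *; lia.
  by rewrite modnDr modn_small -?eb ?subnKC //; rewrite -eb in h1' h2' *; lia.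
suff: g * h = h * g ^+ k by move=> gh; rewrite conjgE gh mulKg.
apply/permP=> x; apply: val_inj; rewrite !permM /= gX !hE gE.
rewrite !add0n !subn0 /= !rotate_lt // bP.
have [h1 h2 h3 sl] := blockP (bP x).
have := ks _ sl; rewrite /flip.
rewrite block_rotate //.
case: ifP => el kl; last first.
  by rewrite iter_rotate // -modnDmr kl modnDmr addn1.
set a := (block s x).1 in h1 h2 h3 *; set l := (block s x).2 in h2 h3 kl *.
have l_gt0 : 0 < l by lia.
have by_ : block s (2 * a + l - x.+1) = block s x by apply: block_same => //; lia.
rewrite iter_rotate ?by_ -/a -/l; last by lia.
rewrite -modnDmr kl modnDmr /rotate -/a -/l.
(* Rotating and then reflecting is reflecting and then stepping back; the last point of a block
   wraps around and is treated apart. *)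
have [lt_l | le_l] := ltnP (x - a).+1 l.
  rewrite modn_small //.
  have -> : 2 * a + l - x.+1 - a + l.-1 = (l - (x - a).+2) + l by lia.
  by rewrite modnDr modn_small; lia.
have -> : (x - a).+1 = l by lia.
have -> : 2 * a + l - x.+1 - a = 0 by lia.
by rewrite modnn modn_small; lia.
Qed.

(** * Lower bounds for alternating groups of degree at least 8 *)

Lemma compatible_conj n (t : {perm 'I_n}) :
  exists2 p : sym_pair 'Alt_('I_n), compatible p
    & {in 'Alt_('I_n), forall x, p.2 (x ^: 'Alt_('I_n)) = (x ^ t) ^: 'Alt_('I_n)}.
Proof.
have nt : t \in 'N('Alt_('I_n)) by rewrite (subsetP (Alt_norm _)) ?inE.
have [||p cp pE] := @compatible_automorphism _ 'Alt_('I_n)%G (conjgm_morphism 'Alt_('I_n) t).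
- exact: injm_conj.
- by rewrite morphim_conj setIid (normP nt).
by exists p => // x Ax; rewrite pE //= conjgmE.
Qed.

Lemma Alt_orders_2_3 n : 3 < n -> exists u v : {perm 'I_n},
  [/\ u \in 'Alt_('I_n), v \in 'Alt_('I_n), u != 1, v != 1 & #[u] <> #[v]].
Proof.
move=> n_gt3; have card2 : (2 * #|'Alt_('I_n)|)%N = n`!.
  by rewrite card_Alt card_ord; lia.
(* [4!] divides [n!], as the binomial coefficient shows; halving gives 12. *)
have d12 : 12 %| #|'Alt_('I_n)|.
  rewrite -(@dvdn_pmul2l 2) // card2 (dvdn_trans (_ : _ %| 4`!)) //.
  by apply/dvdnP; exists ('C(n, 4) * (n - 4)`!)%N; rewrite -(bin_fact n_gt3); lia.
have [|u Au ou] := @Cauchy _ 2 'Alt_('I_n)%G isT; first exact: dvdn_trans d12.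
have [|v Av ov] := @Cauchy _ 3 'Alt_('I_n)%G isT; first exact: dvdn_trans d12.
by exists u, v; split; rewrite // -?order_eq1 ?ou ?ov.
Qed.

Lemma Alt_three_theories n (x t : {perm 'I_n}) : 3 < n -> x \in 'Alt_('I_n) ->
    x ^ t \notin x ^: 'Alt_('I_n) ->
  3 <= num_supercharacter_theories 'Alt_('I_n).
Proof.
move=> n_gt3 Ax xt; have [u [v [Au Av u1 v1 ouv]]] := Alt_orders_2_3 n_gt3.
have [p cp pE] := compatible_conj t.
apply: (three_supercharacter_theories cp Ax _ Au Av u1 v1 ouv).
by rewrite pE // => /class_eqP; apply/negP.
Qed.

(** The power map [a] takes [x] to an odd conjugate and [y] to an even one. Following it with
    conjugation by the odd [hx] exchanges these parities. *)
Lemma Alt_five_theories n k (x hx y hy : {perm 'I_n}) :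
    3 < n -> coprime #|'Alt_('I_n)| k ->
    (forall z, commute x z -> odd_perm z = false) -> x ^ hx = x ^+ k -> odd_perm hx ->
    (forall z, commute y z -> odd_perm z = false) -> y ^ hy = y ^+ k -> ~~ odd_perm hy ->
  5 <= num_supercharacter_theories 'Alt_('I_n).
Proof.
move=> n_gt3 cok cx xk odd_hx cy yk even_hy.
have [u [v [Au Av u1 v1 ouv]]] := Alt_orders_2_3 n_gt3.
have Ax : x \in 'Alt_('I_n) by rewrite Alt_even cx.
have Ay : y \in 'Alt_('I_n) by rewrite Alt_even cy.
have [a ca aE] := compatible_power cok; have [b cb bE] := compatible_conj hx.
have abE z : z \in 'Alt_('I_n) ->
    (a * b).2 (z ^: 'Alt_('I_n)) = ((z ^+ k) ^ hx) ^: 'Alt_('I_n).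
  by move=> Az; rewrite permM aE // bE // groupX.
apply: (five_supercharacter_theories ca (compatibleM ca cb) Ax Ay _ _ _ _ Au Av u1 v1 ouv).
- by rewrite aE // -xk => /class_eqP; rewrite (conj_Alt_class _ cx) odd_hx.
- by rewrite aE // -yk; apply/class_eqP; rewrite (conj_Alt_class _ cy).
- rewrite abE // -yk -conjgM => /class_eqP.
  by rewrite (conj_Alt_class _ cy) odd_permM odd_hx (negPf even_hy).
rewrite abE // -xk -conjgM; apply/class_eqP.
by rewrite (conj_Alt_class _ cx) odd_permM odd_hx.
Qed.

Lemma Alt_five_of_blocks n k s s' (e : pred nat) :
    3 < n -> coprime n`! k -> sumn s = n -> sumn s' = n -> uniq s -> uniq s' ->
    all odd s -> all odd s' ->
    {in s ++ s', forall m, k = (if e m then m.-1 else 1)%N %[mod m]} ->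
    odd (sumn [seq if e m then m./2 else 0 | m <- s]) ->
    ~~ odd (sumn [seq if e m then m./2 else 0 | m <- s']) ->
  5 <= num_supercharacter_theories 'Alt_('I_n).
Proof.
move=> n_gt3 cok sn s'n us us' os os' kss par par'.
have [|x [hx [cx xk odd_hx]]] := block_cycles sn us os (e := e) (k := k).
  by move=> m sm; apply: kss; rewrite mem_cat sm.
have [|y [hy [cy yk odd_hy]]] := block_cycles s'n us' os' (e := e) (k := k).
  by move=> m sm; apply: kss; rewrite mem_cat sm orbT.
apply: (Alt_five_theories n_gt3 _ cx xk _ cy yk); rewrite ?odd_hx ?odd_hy //.
by apply: coprime_dvdl cok; rewrite -[X in X`!](card_ord n) -card_Alt ?card_ord ?dvdn_mull //; lia.
Qed.

(** The exponent [n! - 1] is coprime to [n!] and is -1 modulo every part, as parts are at most [n];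
    so all cycles are reversed. *)
Lemma Alt_five_theories_inv n s s' : 3 < n -> sumn s = n -> sumn s' = n ->
    uniq s -> uniq s' -> all odd s -> all odd s' ->
    odd (sumn [seq m./2 | m <- s]) -> ~~ odd (sumn [seq m./2 | m <- s']) ->
  5 <= num_supercharacter_theories 'Alt_('I_n).
Proof.
move=> n_gt3 sn s'n us us' os os' par par'.
apply: (@Alt_five_of_blocks n n`!.-1 s s' predT) => //.
  have := fact_gt0 n; case: n`! => // d _.
  by rewrite -pred_Sn coprimeSn.
move=> m sm; have m_gt0 : 0 < m.
  have /allP/(_ m sm) : all odd (s ++ s') by rewrite all_cat os.
  by case: m {sm}.
have le_mn : m <= n.
  have sumP r : m \in r -> m <= sumn r.
    by elim: r => //= z r IHr; rewrite inE => /predU1P[-> | /IHr]; lia.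
  by move: sm; rewrite mem_cat => /orP[]/sumP; rewrite ?sn ?s'n.
have /dvdnP[q nq] : m %| n`! by apply: dvdn_fact; rewrite m_gt0.
have := fact_gt0 n; rewrite nq; case: q {nq} => // q _.
have -> : (q.+1 * m).-1 = (q * m + m.-1)%N by lia.
by rewrite modnMDl.
Qed.

Lemma coprime_fact n k : all (coprime^~ k) (iota 1 n) -> coprime n`! k.
Proof.
elim: n => [|n IHn]; first by rewrite fact0 coprime1n.
by rewrite -[n.+1]addn1 iotaD all_cat /= andbT addn1 factS coprimeMl => /andP[/IHn-> ->].
Qed.

(** For [r] odd parts the halves add up to [(n - r) / 2], so inversion separates partitions whose
    numbers of parts differ by 2: one and three parts for odd [n], two and four for even [n]. Four
    distinct odd parts sum to at least 1 + 3 + 5 + 7 = 16, so smaller even [n] require another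
    power. *)
Lemma Alt_ge8_theories n : 7 < n -> 5 <= num_supercharacter_theories 'Alt_('I_n).
Proof.
move=> n_gt7; have [odd_n | even_n] := boolP (odd n).
  have [par | par] := boolP (odd n./2).
    apply: (@Alt_five_theories_inv n [:: n] [:: n - 4; 3; 1]%N) => //=; try lia.
    by rewrite !inE; lia.
  apply: (@Alt_five_theories_inv n [:: n - 4; 3; 1]%N [:: n]) => //=; try lia.
  by rewrite !inE; lia.
have [n_ge16 | n_lt16] := leqP 16 n.
  have [par | par] := boolP (odd (n - 1)./2).
    apply: (@Alt_five_theories_inv n [:: n - 1; 1]%N [:: n - 9; 5; 3; 1]%N) => //=; try lia.
      by rewrite !inE; lia.
    by rewrite !inE; lia.
  apply: (@Alt_five_theories_inv n [:: n - 9; 5; 3; 1]%N [:: n - 1; 1]%N) => //=; try lia.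
    by rewrite !inE; lia.
  by rewrite !inE; lia.
(* k = -1 modulo one part, k = 1 modulo the others *)
have: n \in [:: 8; 10; 12; 14]%N by rewrite !inE; lia.
rewrite !inE => /or4P[] /eqP-> {n_gt7 even_n n_lt16}.
(* Only the part 7 or 11 is reversed; its half, 3 or 5, is odd, so the partition containing it gives
   the odd conjugation. *)
- apply: (@Alt_five_of_blocks 8 181 [:: 7; 1]%N [:: 5; 3]%N (pred1 7) isT
    (@coprime_fact 8 181 isT)) => //.
  by move=> m; rewrite !inE => /or4P[]/eqP->.
- apply: (@Alt_five_of_blocks 10 181 [:: 7; 3]%N [:: 9; 1]%N (pred1 7) isT
    (@coprime_fact 10 181 isT)) => //.
  by move=> m; rewrite !inE => /or4P[]/eqP->.
- apply: (@Alt_five_of_blocks 12 109 [:: 11; 1]%N [:: 9; 3]%N (pred1 11) isT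
    (@coprime_fact 12 109 isT)) => //.
  by move=> m; rewrite !inE => /or4P[]/eqP->.
apply: (@Alt_five_of_blocks 14 703 [:: 11; 3]%N [:: 13; 1]%N (pred1 11) isT
  (@coprime_fact 14 703 isT)) => //.
by move=> m; rewrite !inE => /or4P[]/eqP->.
Qed.

(** * Computations in small alternating groups *)

Section OneLineNotation.

Variable n : nat.
Implicit Types x y : {perm 'I_n}.

Definition code x : seq nat := [seq val (x i) | i <- enum 'I_n].
Definition lmul (a b : seq nat) := [seq nth 0 b i | i <- a].
Definition linv (a : seq nat) := [seq index i a | i <- iota 0 (size a)].

Lemma size_code x : size (code x) = n.
Proof. by rewrite size_map size_enum_ord. Qed.

Lemma nth_code x (i : 'I_n) : nth 0 (code x) i = x i.
Proof. by rewrite (nth_map i) ?size_enum_ord // nth_ord_enum. Qed.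

Lemma code_inj : injective code.
Proof.
by move=> x y e; apply/permP=> i; apply: val_inj; rewrite /= -nth_code e nth_code.
Qed.

Lemma code1 : code 1 = iota 0 n.
Proof.
by rewrite -val_enum_ord; apply: eq_map => i; rewrite perm1.
Qed.

Lemma codeM x y : code (x * y) = lmul (code x) (code y).
Proof. by rewrite /lmul -map_comp; apply: eq_map => i /=; rewrite permM nth_code. Qed.

Lemma codeV x : code x^-1 = linv (code x).
Proof.
rewrite /linv size_code -val_enum_ord -map_comp; apply: eq_map => i /=.
rewrite -{2}(permKV x i) /code (index_map (f := fun j => val (x j))).
  by rewrite index_enum_ord.
by move=> j k /val_inj/perm_inj.
Qed.

Lemma codeP (l : seq nat) : perm_eq l (iota 0 n) -> exists x, code x = l.
Proof.
move=> pl; have sl : size l = n by rewrite (perm_size pl) size_iota.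
have ln i : i < n -> nth 0 l i < n.
  move=> ltin; have: nth 0 l i \in iota 0 n by rewrite -(perm_mem pl) mem_nth ?sl.
  by rewrite mem_iota.
pose f (i : 'I_n) := Ordinal (ln i (ltn_ord i)).
have injf : injective f.
  move=> i j /(congr1 val)/= /eqP; rewrite nth_uniq ?sl //; first by move/eqP/val_inj.
  by rewrite (perm_uniq pl) iota_uniq.
exists (perm injf); apply: (@eq_from_nth _ 0) => [|i]; rewrite size_code ?sl // => ltin.
by rewrite -[i]/(val (Ordinal ltin)) nth_code permE.
Qed.

End OneLineNotation.

Definition cycle3 n a b c :=
  [seq if i == a then b else if i == b then c else if i == c then a else i | i <- iota 0 n].

(* The identity and one 3-cycle [k -> j -> _ -> k] for each [j < k]: coset     *)
(* representatives of the alternating group on [0..k-1] in that on [0..k].     *)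
Definition coset_reps n k := iota 0 n :: [seq cycle3 n k j (j == 0) | j <- iota 0 k].

Definition coset_reps_list n := [seq coset_reps n k | k <- iota 2 (n - 2)].

Definition products n (R : seq (seq (seq nat))) :=
  foldl (fun L S => [seq lmul a b | a <- L, b <- S]) [:: iota 0 n] R.

Definition alt_list n := products n (coset_reps_list n).

(** Reads a list as octal digits. Lists with distinct values are distinct, so sorting these numbers
    certifies that a long list has no repetition. *)
Definition base8 := foldl (fun (v : BinNums.N) (d : nat) => BinNat.N.add (bin_of_nat d)
   (BinNat.N.shiftl v (bin_of_nat 3))) BinNums.N0.

(** The test [t^4 = t] certifies that [t] is even, as the square of [t^2]. Products of such
    elements, distinct and [n! / 2] in number, exhaust the alternating group. *)
Definition alt_list_check n :=
  [&& all (all (fun t => (lmul (lmul t t) (lmul t t) == t) && perm_eq t (iota 0 n)))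
          (coset_reps_list n),
      sorted (fun u v => BinNat.N.ltb u v)
        (sort (fun u v => BinNat.N.leb u v) (map base8 (alt_list n)))
    & (2 * size (alt_list n))%N == n`!].

Lemma products_even n (R : seq (seq (seq nat))) l :
    all (all (fun t => (lmul (lmul t t) (lmul t t) == t) && perm_eq t (iota 0 n))) R ->
    l \in products n R ->
  exists2 x : {perm 'I_n}, x \in 'Alt_('I_n) & code x = l.
Proof.
move=> evR; elim/last_ind: R l evR => [|R S IHR] l.
  by move=> _ /[!inE]/eqP->; exists 1; rewrite ?group1 ?code1.
rewrite all_rcons /products foldl_rcons => /andP[/allP evS /IHR{}IHR].
case/allpairsP=> -[a b] /= [/IHR[x Ax <-] /evS/andP[/eqP b4 pb] ->].
have [y yb] := codeP pb; exists (x * y); last by rewrite codeM yb.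
rewrite groupM // -(_ : (y * y) * (y * y) = y).
  by rewrite Alt_even odd_permM addbb.
by apply: (@code_inj n); rewrite !codeM yb.
Qed.

Lemma alt_listP n : alt_list_check n -> 1 < n ->
  perm_eq (alt_list n) [seq code x | x <- enum ('Alt_('I_n))].
Proof.
case/and3P=> evR sortL /eqP sizeL n_gt1.
have uL : uniq (alt_list n).
  apply: (@map_uniq _ _ base8); rewrite -(sort_uniq (fun u v => BinNat.N.leb u v)).
  apply: sorted_uniq sortL => [u v w | u].
    rewrite -!/(is_true _); move=> /BinNat.N.ltb_lt uv /BinNat.N.ltb_lt vw.
    by apply/BinNat.N.ltb_lt; apply: BinNat.N.lt_trans uv vw.
  exact: BinNat.N.ltb_irrefl.
have sub : {subset alt_list n <= [seq code x | x <- enum ('Alt_('I_n))]}.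
  move=> l /(products_even evR)[x Ax <-].
  by apply: map_f; rewrite mem_enum.
have [|_ eqi] := uniq_min_size uL sub.
  rewrite size_map -cardE -(leq_pmul2l (ltn0Sn 1)) sizeL.
  by rewrite card_Alt card_ord.
apply: uniq_perm => //; rewrite map_inj_uniq ?enum_uniq //; exact: code_inj.
Qed.

Lemma mem_alt_list n l : alt_list_check n -> 1 < n ->
  reflect (exists2 x, x \in 'Alt_('I_n) & l = code x) (l \in alt_list n).
Proof.
move=> chk n1; rewrite (perm_mem (alt_listP chk n1)).
by apply: (iffP mapP) => -[x Ax ->]; exists x; rewrite // ?mem_enum // in Ax *.
Qed.

Lemma card_alt_code n (P : pred (seq nat)) : alt_list_check n -> 1 < n ->
  #|[set x in 'Alt_('I_n) | P (code x)]| = count P (alt_list n).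
Proof.
move=> chk n1; rewrite (seq.permP (alt_listP chk n1) P) count_map cardE -size_filter.
apply/perm_size/uniq_perm => [||x]; [exact: enum_uniq | exact/filter_uniq/enum_uniq|].
by rewrite [in LHS]mem_enum inE [in RHS]mem_filter mem_enum andbC.
Qed.

(** * Recognition of conjugacy classes by a key *)

Fixpoint inversions (s : seq nat) :=
  if s is a :: s' then odd (count (fun b => b < a) s') (+) inversions s' else false.

Definition fixed_points (a : seq nat) :=
  count (fun p => p.1 == p.2) (zip a (iota 0 (size a))).

(* The numbers of fixed points of a, a^2, a^3 separate the classes of the     *)
(* symmetric group that are needed; the classes of n-cycles split in the      *)
(* alternating group according to the sign of i |-> a^i(0).                   *)
Definition key (a : seq nat) :=
  let a2 := lmul a a in
  [:: fixed_points a; fixed_points a2; fixed_points (lmul a2 a);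
      let o := traject (nth 0 a) 0 (size a) in
      if uniq o then (inversions o).+1 else 0].

(** The last two tests say that conjugates of a representative have its key, and that the number of
    elements with this key times the order of the centralizer is the order of the group. *)
Definition class_check n (reps : seq (seq nat)) :=
  let L := alt_list n in let K := map key reps in
  [&& uniq K, nth [::] reps 0 == iota 0 n, all (fun r => r \in L) reps,
      all (fun y => key y \in K) L,
      all (fun y => let y' := linv y in
             all (fun r => key (lmul (lmul y' r.1) y) == r.2) (zip reps K)) L
    & all (fun r => (count (fun y => key y == r.2) L
             * count (fun z => lmul r.1 z == lmul z r.1) L)%N == size L) (zip reps K)].

Definition decode n (l : seq nat) : {perm 'I_n} := odflt 1 [pick x | code x == l].

Lemma codeK n : cancel (@code n) (decode n).
Proof.
move=> x; rewrite /decode; case: pickP => [y /eqP/code_inj // | /(_ x)].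
by rewrite eqxx.
Qed.

Section Classes.

Variables (n : nat) (reps : seq (seq nat)).
Hypotheses (n_gt1 : 1 < n) (altC : alt_list_check n) (classC : class_check n reps).

Let G := 'Alt_('I_n)%G.
Let m := size reps.
Definition class_index l := index (key l) (map key reps).
Definition class_rep k := decode n (nth [::] reps k).

Lemma class_repP k : k < m ->
  class_rep k \in G /\ code (class_rep k) = nth [::] reps k.
Proof.
move=> ltkm; case/and5P: classC => _ _ /allP/(_ _ (mem_nth [::] ltkm)) + _ _.
by case/(mem_alt_list _ altC n_gt1) => x Ax e; rewrite /class_rep e codeK.
Qed.

Lemma class_index_lt x : x \in G -> class_index (code x) < m.
Proof.
move=> Gx; rewrite /m -(size_map key) index_mem.
case/and5P: classC => _ _ _ /allP + _; apply; apply/mem_alt_list => //.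
by exists x.
Qed.

Lemma class_index_rep k : k < m -> class_index (code (class_rep k)) = k.
Proof.
move=> ltkm; have [_ ->] := class_repP ltkm.
rewrite /class_index -(nth_map _ [::]) // index_uniq ?size_map //.
by case/and5P: classC.
Qed.

Lemma class_rep0 : 0 < m -> class_rep 0 = 1.
Proof.
move=> m_gt0; have [_ e0] := class_repP m_gt0; apply: (@code_inj n).
by rewrite e0 code1; case/and5P: classC => _ /eqP.
Qed.

(** By the orbit-stabilizer formula the class of [r] has as many elements as the set [A] of elements
    with its key, in which it is contained. *)
Lemma class_indexP x : x \in G -> (x \in class_rep (class_index (code x)) ^: G).
Proof.
move=> Gx; set k := class_index _; have ltkm : k < m by apply: class_index_lt.
have [Gr codr] := class_repP ltkm; set r := class_rep k in Gr codr *.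
have keyr : nth [::] (map key reps) k = key (code r) by rewrite (nth_map [::]) ?codr.
have keyx : key (code x) = key (code r).
  by rewrite -keyr nth_index // -index_mem size_map class_index_lt.
have rK : (code r, key (code r)) \in zip reps (map key reps).
  apply/(nthP ([::], [::])); exists k; first by rewrite size_zip size_map minnn.
  by rewrite nth_zip ?size_map // keyr codr.
case/and5P: classC => _ _ _ _ /andP[/allP conjC /allP/(_ _ rK)/= /eqP cardC].
pose A := [set y in 'Alt_('I_n) | key (code y) == key (code r)].
have sA : r ^: G \subset A.
  apply/subsetP=> _ /imsetP[z Gz ->]; rewrite inE groupJ //=.
  rewrite conjgE mulgA !codeM codeV.
  have /conjC/allP/(_ _ rK) // : code z \in alt_list n by apply/mem_alt_list => //; exists z.
suff /eqP-> : r ^: G == A by rewrite inE keyx eqxx andbT.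
rewrite eqEcard sA /=.
have cent : #|'C_G[r]| = count (fun z => lmul (code r) z == lmul z (code r)) (alt_list n).
  rewrite -card_alt_code //; apply: eq_card => z; rewrite in_setI [RHS]inE; congr (_ && _).
  rewrite -!codeM (inj_eq (@code_inj n)); by apply/cent1P/eqP => /esym.
have sizeL : size (alt_list n) = #|G|.
  by rewrite (perm_size (alt_listP altC n_gt1)) size_map -cardE.
rewrite -(leq_pmul2r (cardG_gt0 'C_G[r])) {1}cent.
rewrite (card_alt_code (fun l => key l == key (code r)) altC n_gt1) cardC sizeL.
by rewrite -index_cent1 mulnC Lagrange ?subsetIl.
Qed.

End Classes.

(* Restricted growth lists: entry k is the least index in the block of k.     *)
Definition extend_partitions (R : seq (seq nat)) k :=
  [seq rcons l v | l <- R, v <- k :: [seq j <- iota 0 k | nth 0 l j == j]].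

Definition set_partitions m := foldl extend_partitions [:: [::]] (iota 0 m).

(** The list encodes the partition into fibres of [f]. By induction, its last entry is either the
    least index of an earlier equal value or [m] itself. *)
Lemma set_partitionsP (T : eqType) (f : nat -> T) m :
  [seq index (f k) (mkseq f m) | k <- iota 0 m] \in set_partitions m.
Proof.
have iotaSr k : iota 0 k.+1 = rcons (iota 0 k) k by rewrite -addn1 iotaD cats1.
elim: m => [|m IHm]; first by rewrite inE.
rewrite /set_partitions [in foldl _ _ _]iotaSr foldl_rcons.
set l := map _ _ in IHm; apply/allpairsPdep.
exists l, (index (f m) (mkseq f m.+1)); split=> //; last first.
  rewrite iotaSr map_rcons; congr rcons.
  apply/eq_in_map=> k; rewrite mem_iota add0n => /andP[_ ltkm].
  rewrite /mkseq iotaSr map_rcons -cats1 index_cat ifT //.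
  by rewrite map_f // mem_iota.
rewrite /mkseq iotaSr map_rcons -cats1 index_cat -/(mkseq f m) size_mkseq /= eqxx.
rewrite addn0 inE; case: ifP => [fm | _]; last by rewrite eqxx.
have lt_im : index (f m) (mkseq f m) < m by rewrite -[X in _ < X](size_mkseq f m) index_mem.
apply/orP; right; rewrite mem_filter mem_iota /= lt_im andbT.
rewrite /l (nth_map 0) ?size_iota // nth_iota // add0n.
by rewrite -{1}(nth_mkseq (f m) f lt_im) nth_index.
Qed.

(** * Structure constants in tables of binary counters *)

Section Tables.

Lemma nat_of_bin_add u v : nat_of_bin (BinNat.N.add u v) = nat_of_bin u + nat_of_bin v.
Proof. by case: u v => [|p] [|q] //=; rewrite ?addn0 // nat_of_add_pos. Qed.

Lemma nat_of_bin_succ u : nat_of_bin (BinNat.N.succ u) = (nat_of_bin u).+1.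
Proof. by case: u => //= p; rewrite nat_of_succ_pos. Qed.

Fixpoint update A (f : A -> A) i (s : seq A) :=
  match s, i with
  | x :: s', 0 => f x :: s'
  | x :: s', i'.+1 => x :: update f i' s'
  | [::], _ => [::]
  end.

Definition tally m (P : seq (nat * nat)) :=
  foldr (fun ij => update (update BinNat.N.succ ij.2) ij.1)
    (nseq m (nseq m BinNums.N0)) P.

Definition block_sum A (F : A -> BinNums.N) (b : seq nat) (p : nat) (s : seq A) :=
  foldr (fun (xc : A * nat) v => if xc.2 == p then BinNat.N.add (F xc.1) v else v)
    BinNums.N0 (zip s b).

Definition table_sum b p q := block_sum (block_sum id b q) b p.

Lemma size_update A (f : A -> A) i s : size (update f i s) = size s.
Proof. by elim: s i => [|x s IHs] [|i] //=; rewrite IHs. Qed.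

Lemma nth_update A x0 (f : A -> A) i j s : j < size s ->
  nth x0 (update f i s) j = if i == j then f (nth x0 s j) else nth x0 s j.
Proof. by elim: s i j => [|x s IHs] [|i] [|j] //=; rewrite ltnS => /IHs->. Qed.

Lemma block_sum_update A (F : A -> BinNums.N) f d b p i s x0 :
    i < size s -> size s = size b ->
    nat_of_bin (F (f (nth x0 s i))) = nat_of_bin (F (nth x0 s i)) + d ->
  nat_of_bin (block_sum F b p (update f i s))
    = nat_of_bin (block_sum F b p s) + (if nth 0 b i == p then d else 0).
Proof.
rewrite /block_sum; elim: s i b => [|x s IHs] [|i] [|c b] //=.
  by move=> _ _; case: eqP => _ Fd; rewrite ?nat_of_bin_add ?Fd; lia.
rewrite ltnS => ltis [eqs] Fd; have {}IHs := IHs i b ltis eqs Fd.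
by case: (c == p) => //; rewrite !nat_of_bin_add IHs addnA.
Qed.

Lemma table_sum_tally m b p q P :
    size b = m -> all (fun ij => (ij.1 < m) && (ij.2 < m)) P ->
  nat_of_bin (table_sum b p q (tally m P))
    = count (fun ij => (nth 0 b ij.1 == p) && (nth 0 b ij.2 == q)) P.
Proof.
move=> sb; have shape Q : size (tally m Q) = m
    /\ forall i, i < m -> size (nth [::] (tally m Q) i) = m.
  elim: Q => [|[i j] Q [IH1 IH2]] /=.
    by rewrite size_nseq; split=> // i ltim; rewrite nth_nseq ltim size_nseq.
  rewrite size_update; split=> // k ltkm.
  by rewrite nth_update ?IH1 //; case: eqP; rewrite ?size_update IH2.
elim: P => [|[i j] P IHP] /=.
  move=> _; have zsum A (F : A -> BinNums.N) c x r : F x = BinNums.N0 ->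
      block_sum F c r (nseq m x) = BinNums.N0.
    rewrite /block_sum => F0; elim: (m) c => [|k IHk] [|d c] //=.
    by rewrite IHk F0; case: ifP.
  by rewrite /table_sum !zsum.
case/andP=> /andP[ltim ltjm] /IHP{}IHP; have [s1 s2] := shape P.
rewrite /table_sum (@block_sum_update _ _ _ (nth 0 b j == q) _ _ _ _ [::]) ?s1 ?sb //.
  rewrite -/(table_sum b p q (tally m P)) IHP addnC; congr (_ + _).
  by case: (nth 0 b i == p).
rewrite (@block_sum_update _ _ _ 1 _ _ _ _ BinNums.N0) ?s2 ?sb //.
by rewrite nat_of_bin_succ addn1.
Qed.

End Tables.

(** For a representative [r], entry [(i, j)] counts the factorizations of [r] as [u^-1] in class [i]
    times [u * r] in class [j]. The class of [u^-1] is computed once for all [r]. *)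
Definition structure_constants n reps :=
  let K := map key reps in
  let L := [seq (u, index (key (linv u)) K) | u <- alt_list n] in
  [seq tally (size reps) [seq (ui.2, index (key (lmul ui.1 r)) K) | ui <- L] | r <- reps].

(* The constraint (k, (i, j)) says that two elements of the same block, with  *)
(* classes k and b_k, are products of an element of the block of i and one of *)
(* the block of j in equally many ways.                                       *)
Definition schur_condition (C : seq (seq (seq BinNums.N)))
    (kij : nat * (nat * nat)) (b : seq nat) :=
  let: (k, (i, j)) := kij in
  let bk := nth 0 b k in let bi := nth 0 b i in let bj := nth 0 b j in
  if [|| bk == k, bi != i | bj != j] then true
  else table_sum b i j (nth [::] C k) == table_sum b i j (nth [::] C bk).

(** Class 0 is the identity, so [0 \notin behead b] leaves it alone in its block. The constraints
    are applied in turn, each to the partitions still surviving. *)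
Definition schur_partitions n (reps : seq (seq nat)) :=
  let C := structure_constants n reps in
  foldl (fun R kij => [seq b <- R | schur_condition C kij b])
    [seq b <- set_partitions (size reps) | 0 \notin behead b]
    [seq (k, ij) | k <- iota 0 (size reps),
       ij <- [seq (i, j) | i <- iota 0 (size reps), j <- iota 0 (size reps)]].

(** * The upper bound from admissible partitions of classes *)

Section UpperBound.

Variables (n : nat) (reps : seq (seq nat)).
Hypotheses (n_gt1 : 1 < n) (altC : alt_list_check n) (classC : class_check n reps).

Let G := 'Alt_('I_n)%G.
Let m := size reps.
Local Notation rep := (class_rep n reps).
Local Notation idx := (class_index reps).

(** The partition of class indices induced by [KK], encoded as in [set_partitions]. *)
Definition block_code (KK : {set {set {set {perm 'I_n}}}}) :=
  let B k := pblock KK (rep k ^: G) in [seq index (B k) (mkseq B m) | k <- iota 0 m].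

Lemma size_block_code KK : size (block_code KK) = m.
Proof. by rewrite size_map size_iota. Qed.

Lemma block_codeE KK i j : i < m -> j < m ->
  (nth 0 (block_code KK) i == nth 0 (block_code KK) j)
    = (pblock KK (rep i ^: G) == pblock KK (rep j ^: G)).
Proof.
move=> lim ljm; rewrite !(nth_map 0) ?size_iota // !nth_iota // !add0n.
set B := fun k => pblock KK (rep k ^: G); rewrite -![pblock _ _]/(B _).
have memB k : k < m -> B k \in mkseq B m by move=> lkm; rewrite map_f // mem_iota.
apply/eqP/eqP => [e | -> //].
by rewrite -(nth_index (B i) (memB i lim)) e nth_index ?memB.
Qed.

Lemma foldl_filterE (T S : eqType) (P : S -> pred T) (s : seq S) (r : seq T) x :
  (x \in foldl (fun R k => [seq y <- R | P k y]) r s) = (x \in r) && all (P^~ x) s.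
Proof.
elim: s r => [|k s IHs] r /=; first by rewrite andbT.
by rewrite IHs mem_filter -andbA andbCA.
Qed.

Section Theory.

Variables (XX : {set {set Iirr G}}) (KK : {set {set {set {perm 'I_n}}}}).
Hypothesis thT : supercharacter_theory (XX, KK).
Let b := block_code KK.

Let pK : partition KK (classes G). Proof. by case: thT => -[_ pKK]. Qed.
Let tK := partition_trivIset pK.

Let KKrep x : x \in G -> pblock KK (x ^: G) \in KK.
Proof. by move=> Gx; rewrite pblock_mem // (cover_partition pK) mem_classes. Qed.

Let sK B : B \in KK -> B \subset classes G.
Proof. by rewrite -(cover_partition pK) => KB; apply: bigcup_sup. Qed.

Lemma mem_block_code x i : x \in G -> i < m ->
  (nth 0 b (idx (code x)) == nth 0 b i)
    = (x \in cover (pblock KK (rep i ^: G))).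
Proof.
move=> Gx lim; have Gi := (class_repP n_gt1 altC classC lim).1.
rewrite block_codeE // ?(class_index_lt n_gt1) //.
have /class_eqP <- := class_indexP n_gt1 altC classC Gx.
rewrite eq_pblock ?(cover_partition pK) ?mem_classes //.
rewrite (mem_cover_classes _ (sK (KKrep Gi))) Gx /=.
by rewrite -!eq_pblock ?(cover_partition pK) ?mem_classes // eq_sym.
Qed.

(** The tables count products from two blocks, and by [card_block_product] these counts agree within
    a block. *)
Lemma block_code_schur : b \in schur_partitions n reps.
Proof.
pose B k := pblock KK (rep k ^: G).
have memB k : k < m -> B k \in mkseq B m by move=> ltkm; rewrite map_f // mem_iota.
have nthb k : k < m -> nth 0 b k < m.
  move=> ltkm; rewrite (nth_map 0) ?size_iota // nth_iota // add0n.
  by rewrite -[X in _ < X](size_mkseq B m) index_mem memB.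
have nthbb k : k < m -> nth 0 b (nth 0 b k) = nth 0 b k.
  move=> ltkm; apply/eqP; rewrite block_codeE ?nthb //.
  rewrite (nth_map 0) ?size_iota // nth_iota // add0n.
  rewrite -![pblock _ _]/(B _) -/(mkseq B m).
  have ltim : index (B k) (mkseq B m) < m.
    by rewrite -[X in _ < X](size_mkseq B m) index_mem memB.
  by rewrite -{1}(nth_mkseq (B k) B ltim) nth_index ?memB.
rewrite /schur_partitions foldl_filterE; apply/andP; split.
  rewrite mem_filter set_partitionsP andbT; apply/negP.
  case/(nthP 0) => k; rewrite size_behead size_block_code => ltk.
  rewrite nth_behead => bk0; have ltkm : k.+1 < m by lia.
  have m_gt0 : 0 < m by lia.
  have b0 : nth 0 b 0 = 0.
    by rewrite (nth_map 0) ?size_iota // nth_iota // /mkseq -(prednK m_gt0) /= eqxx.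
  have /eqP: nth 0 b k.+1 == nth 0 b 0 by rewrite bk0 b0.
  move/eqP; rewrite block_codeE // (class_rep0 n_gt1 altC classC) // => /eqP eB.
  have [Gk _] := class_repP n_gt1 altC classC ltkm.
  have K1 : [set (1 ^: G)] \in KK by case: thT.
  have: rep k.+1 ^: G \in pblock KK (1 ^: G).
    by rewrite -eB mem_pblock (cover_partition pK) mem_classes.
  rewrite (def_pblock tK K1) ?inE // class1G classG_eq1 => /eqP r1.
  have := class_index_rep n_gt1 altC classC ltkm.
  rewrite r1 -(class_rep0 n_gt1 altC classC) //.
  by rewrite (class_index_rep n_gt1 altC classC).
apply/allP=> _ /allpairsP[[k _] /= [+ /allpairsP[[i j] /= [+ + ->]] ->]].
rewrite !mem_iota !add0n => ltkm ltim ltjm.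
rewrite /schur_condition; set bk := nth 0 b k.
case: ifP => // /norP[_ /norP[/negPn/eqP bi /negPn/eqP bj]].
have blockP x l : x \in G -> l < m -> nth 0 b l = l ->
    (nth 0 b (idx (code x)) == l) = (x \in cover (pblock KK (rep l ^: G))).
  by move=> Gx ltlm bl; rewrite -mem_block_code // bl.
have tabE l : l < m -> nat_of_bin (table_sum b i j (nth [::] (structure_constants n reps) l))
    = #|[set u in cover (pblock KK (rep i ^: G)) |
          u^-1 * rep l \in cover (pblock KK (rep j ^: G))]|.
  move=> ltlm; have [Gl codel] := class_repP n_gt1 altC classC ltlm.
  rewrite (nth_map [::]) // table_sum_tally ?size_block_code //; last first.
    apply/allP=> _ /mapP[[u _] /mapP[_ /(mem_alt_list _ altC n_gt1)[x Gx ->]] [-> ->] ->] /=.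
    have {}Gx : x \in G := Gx.
    have [Gx' Gxl] : x^-1 \in G /\ x * rep l \in G by rewrite groupM ?groupV.
    rewrite -codel -codeV -codeM.
    by rewrite (class_index_lt n_gt1 altC classC Gx') (class_index_lt n_gt1 altC classC Gxl).
  (* The tables run over [u] with [u^-1] in the first block; inversion turns this into a count of
     first factors. *)
  rewrite !count_map -(card_alt_code _ altC n_gt1) -(card_imset _ invg_inj) /=.
  apply: eq_card => u; apply/imsetP/idP.
  - case=> x /setIdP[Gx /=]; rewrite -codel -codeV -codeM !blockP ?groupM ?groupV //.
    by move=> /andP[xi xj] ->; apply/setIdP; rewrite invgK.
  case/setIdP=> ui uj; have Gi := (class_repP n_gt1 altC classC ltim).1.
  have Gu : u \in G by move: ui; rewrite (mem_cover_classes _ (sK (KKrep Gi))) => /andP[].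
  exists u^-1; last by rewrite invgK.
  apply/setIdP; rewrite groupV; split=> //.
  by rewrite /= -codel -codeV -codeM invgK !blockP ?groupM ?groupV // ui uj.
rewrite -(inj_eq (can_inj nat_of_binK)) !tabE ?nthb //; apply/eqP.
have memKK l : l < m -> pblock KK (rep l ^: G) \in KK.
  by move=> ltlm; apply: KKrep; have [] := class_repP n_gt1 altC classC ltlm.
apply: (card_block_product thT (memKK i ltim) (memKK j ltjm) (memKK k ltkm)).
  have [Gk _] := class_repP n_gt1 altC classC ltkm.
  by rewrite -mem_block_code // (class_index_rep n_gt1).
have [Gk _] := class_repP n_gt1 altC classC (nthb k ltkm).
by rewrite -mem_block_code // (class_index_rep n_gt1) ?nthb // nthbb.
Qed.

End Theory.

(** The code tells which classes share a block, so it determines [KK], which determines [XX]. *)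
Lemma block_code_inj XX KK XX' KK' :
    supercharacter_theory (G := G) (XX, KK) -> supercharacter_theory (G := G) (XX', KK') ->
  block_code KK = block_code KK' -> (XX, KK) = (XX', KK').
Proof.
have half P P' Q Q' : supercharacter_theory (G := G) (P, Q) ->
    supercharacter_theory (G := G) (P', Q') ->
    block_code Q = block_code Q' -> Q \subset Q'.
  move=> thP thP' eb; apply/subsetP=> B QB.
  case: (thP) (thP') => -[_ pQ] _ _ _ -[[_ pQ'] _ _ _].
  have sQ D : D \in Q -> D \subset classes G.
    by rewrite -(cover_partition pQ) => KD; apply: bigcup_sup.
  have /set0Pn[K BK] := partition_neq0 pQ QB.
  have CK : K \in classes G := subsetP (sQ B QB) K BK.
  have repK L : L \in classes G -> exists2 k, k < m & L = rep k ^: G.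
    case/imsetP=> x Gx ->; exists (idx (code x)); first exact: class_index_lt.
    by apply/class_eqP; apply: class_indexP.
  have Gr k : k < m -> rep k ^: G \in classes G.
    by move=> ltkm; rewrite mem_classes // (class_repP n_gt1 altC classC ltkm).1.
  suff <- : pblock Q' K = B by rewrite pblock_mem // (cover_partition pQ').
  have <- : pblock Q K = B := def_pblock (partition_trivIset pQ) QB BK.
  have [tQ tQ'] := (partition_trivIset pQ, partition_trivIset pQ').
  have [k ltkm defK] := repK K CK.
  have memE (S : {set {set {set {perm 'I_n}}}}) L : partition S (classes G) ->
      L \in classes G -> (L \in pblock S K) = (pblock S K == pblock S L).
    by move=> pS CL; rewrite eq_pblock ?(partition_trivIset pS) ?(cover_partition pS).
  apply/setP=> L; have [CL | nL] := boolP (L \in classes G).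
    rewrite !memE //; have [l ltlm ->] := repK L CL.
    by rewrite defK -!block_codeE // eb.
  have nocl S : partition S (classes G) -> L \in pblock S K = false.
    move=> pS; apply: contraNF nL => SL; rewrite -(cover_partition pS).
    by rewrite -mem_pblock (same_pblock (partition_trivIset pS) SL).
  by rewrite !nocl.
move=> th1 th2 eb; have eK : KK = KK'.
  apply/eqP; rewrite eqEsubset; apply/andP; split.
    exact: half th1 th2 eb.
  exact: half th2 th1 (esym eb).
by rewrite -eK in th2 *; rewrite (supercharacter_theory_inj th1 th2).
Qed.

Lemma num_supercharacter_theories_le :
  num_supercharacter_theories 'Alt_('I_n) <= size (schur_partitions n reps).
Proof.
rewrite /num_supercharacter_theories cardE -(size_map (fun T => block_code T.2)).
apply: uniq_leq_size.
  rewrite map_inj_in_uniq ?enum_uniq // => -[XX KK] [XX' KK'].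
  by rewrite !mem_enum !inE => /asboolP th /asboolP th' /(block_code_inj th th').
move=> _ /mapP[[XX KK] + ->]; rewrite mem_enum inE => /asboolP.
exact: block_code_schur.
Qed.

End UpperBound.

(** * Automorphisms given by tables, and the group [A_6] *)

Section AutomorphismTable.

Variables (n : nat) (R' : seq (seq (seq nat))).

(** Both lists of products are formed in the same order, so a product of representatives goes to the
    product of their images. *)
Definition image (l : seq nat) := nth [::] (products n R') (index l (alt_list n)).

(* R' lists images for coset_reps_list n; multiplicativity is only tested     *)
(* when the right factor is a coset representative.                           *)
Definition automorphism_check :=
  let L := zip (alt_list n) (products n R') in
  let T := zip (flatten (coset_reps_list n)) (flatten R') in
  [&& size (products n R') == size (alt_list n),
      size (flatten R') == size (flatten (coset_reps_list n)),
      all (all (fun t => (lmul (lmul t t) (lmul t t) == t) && perm_eq t (iota 0 n))) R',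
      all (fun l => all (fun t => image (lmul l.1 t.1) == lmul l.2 t.2) T) L
    & (image (iota 0 n) == iota 0 n)
      && all (fun l => (l.2 == iota 0 n) ==> (l.1 == iota 0 n)) L].

Definition nonconjugate (a b : seq nat) := all (fun z => lmul a z != lmul z b) (alt_list n).

Hypotheses (n_gt1 : 1 < n) (altC : alt_list_check n).

Lemma decode_alt l : l \in alt_list n ->
  decode n l \in 'Alt_('I_n) /\ code (decode n l) = l.
Proof. by move=> /(mem_alt_list _ altC n_gt1)[x Ax ->]; rewrite codeK. Qed.

Lemma nonconjugateP (x y : {perm 'I_n}) :
  nonconjugate (code x) (code y) -> y \notin x ^: 'Alt_('I_n).
Proof.
move=> /allP nc; apply/imsetP=> [[z Az yz]].
have /nc/eqP[] : code z \in alt_list n by apply/mem_alt_list => //; exists z.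
by rewrite -!codeM yz -conjgC.
Qed.

Lemma automorphism_of_table : automorphism_check ->
  exists2 f : {morphism 'Alt_('I_n) >-> {perm 'I_n}},
  'injm f /\ f @* 'Alt_('I_n) = 'Alt_('I_n)
  & {in 'Alt_('I_n), forall x, code (f x) = image (code x)}.
Proof.
case/and5P=> /eqP sizeF /eqP sizeR evF /allP homF /andP[/eqP image1 /allP kerF].
pose f (x : {perm 'I_n}) := decode n (image (code x)).
have zipF x : x \in 'Alt_('I_n) ->
    (code x, image (code x)) \in zip (alt_list n) (products n R').
  move=> Ax; have Lx : code x \in alt_list n by apply/(mem_alt_list _ altC n_gt1); exists x.
  apply/(nthP ([::], [::])); exists (index (code x) (alt_list n)).
    by rewrite size_zip sizeF minnn index_mem.
  by rewrite nth_zip // nth_index.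
have fP x : x \in 'Alt_('I_n) -> f x \in 'Alt_('I_n) /\ code (f x) = image (code x).
  move=> Ax; have : image (code x) \in (products n R').
    by rewrite mem_nth // sizeF index_mem; apply/(mem_alt_list _ altC n_gt1); exists x.
  by rewrite /f => /(products_even evF)[y Ay <-]; rewrite codeK.
have codef x : x \in 'Alt_('I_n) -> code (f x) = image (code x) by case/fP.
have evL : all (all (fun t => (lmul (lmul t t) (lmul t t) == t) && perm_eq t (iota 0 n)))
    (coset_reps_list n) by case/and3P: altC.
(* Induction on the number of factors: under [f], right multiplication by a product of
   representatives becomes right multiplication by a fixed element. *)
have homl R l : {subset R <= coset_reps_list n} -> l \in products n R ->
    exists2 y, y \in 'Alt_('I_n) /\ code y = l &
    exists y', {in 'Alt_('I_n), forall x, f (x * y) = f x * y'}.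
  elim/last_ind: R l => [|R S IHR] l sR.
    move=> /[!inE]/eqP->; exists 1; rewrite ?group1 ?code1 //.
    by exists 1 => x _; rewrite !mulg1.
  rewrite /products foldl_rcons => /allpairsP[[a b] /= [Ra Sb ->]].
  have [|y [Ay <-] [y' yE]] := IHR a _ Ra.
    by move=> T RT; apply: sR; rewrite mem_rcons inE RT orbT.
  have LS : S \in coset_reps_list n by apply: sR; rewrite mem_rcons mem_head.
  have Tb : b \in flatten (coset_reps_list n) by apply/flattenP; exists S.
  have /andP[/eqP b4 pb] := allP (allP evL S LS) b Sb.
  have [z zb] := codeP pb.
  have Az : z \in 'Alt_('I_n).
    rewrite -(_ : (z * z) * (z * z) = z); first by rewrite Alt_even odd_permM addbb.
    by apply: (@code_inj n); rewrite !codeM zb.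
  have [w wE] : exists w, {in 'Alt_('I_n), forall x, f (x * z) = f x * w}.
    set T := flatten _ in Tb; set T' := flatten R' in homF.
    have sT : size T = size T' by rewrite /T' sizeR.
    pose b' := nth [::] T' (index b T).
    have zT : (b, b') \in zip T T'.
      apply/(nthP ([::], [::])); exists (index b T).
        by rewrite size_zip -sT minnn index_mem.
      by rewrite nth_zip // nth_index.
    have [w wb] : exists w : {perm 'I_n}, code w = b'.
      have /flattenP[S' FS' Sb'] : b' \in T' by rewrite mem_nth -?sT ?index_mem.
      by have /andP[_ /codeP] := allP (allP evF S' FS') b' Sb'.
    exists w => x Ax; apply: (@code_inj n); rewrite codeM !codef ?groupM //.
    have /allP/(_ _ zT) := homF _ (zipF x Ax).
    by rewrite /= codeM zb wb => /eqP.
  exists (y * z); first by rewrite groupM // codeM zb.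
  by exists (y' * w) => x Ax; rewrite !mulgA wE ?groupM // yE.
have f1 : f 1 = 1 by apply: (@code_inj n); rewrite codef ?group1 // code1 image1.
have fM : {in 'Alt_('I_n) &, {morph f : x y / x * y}}.
  move=> x y Ax Ay; have Ly : code y \in alt_list n by apply/(mem_alt_list _ altC n_gt1); exists y.
  have [//|z [Az /code_inj->] [z' zE]] := homl (coset_reps_list n) (code y) _ Ly.
  by rewrite zE //; congr (_ * _); rewrite -[y in f y]mul1g zE ?group1 // f1 mul1g.
pose F := Morphism fM.
have injF : 'injm F.
  apply/subsetP=> x kx; have [Ax fx] := (dom_ker kx, mker kx).
  have := kerF _ (zipF x Ax); rewrite /= -codef // (_ : f x = 1) // code1 eqxx /=.
  by rewrite -code1 inE => /eqP/code_inj->.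
exists F => //; split=> //; apply/eqP; rewrite eqEcard card_injm // leqnn andbT.
by apply/subsetP=> _ /morphimP[x _ Ax ->]; have [] := fP x Ax.
Qed.

End AutomorphismTable.

(* The images of coset_reps_list 6 under an outer automorphism of A_6: the    *)
(* action on the six 1-factorizations of K_6, numbered so that the 5-cycle    *)
(* (0 1 2 3 4) is fixed.                                                      *)
Definition outer_images : seq (seq (seq nat)) :=
  ([:: [:: [:: 0; 1; 2; 3; 4; 5]; [:: 5; 4; 1; 0; 2; 3]; [:: 3; 2; 4; 5; 1; 0]];
   [:: [:: 0; 1; 2; 3; 4; 5]; [:: 1; 2; 0; 5; 3; 4]; [:: 2; 0; 1; 4; 5; 3]; [:: 1; 5; 4; 2; 3; 0]];
   [:: [:: 0; 1; 2; 3; 4; 5]; [:: 3; 0; 4; 1; 5; 2]; [:: 1; 3; 5; 0; 2; 4]; [:: 4; 0; 3; 5; 1; 2];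
    [:: 2; 5; 4; 1; 0; 3]];
   [:: [:: 0; 1; 2; 3; 4; 5]; [:: 2; 3; 5; 4; 1; 0]; [:: 5; 4; 0; 1; 3; 2]; [:: 3; 2; 5; 4; 0; 1];
    [:: 4; 3; 1; 2; 5; 0]; [:: 2; 5; 3; 0; 1; 4]]])%N.

Definition cycle3_6 : seq nat := ([:: 1; 2; 0; 3; 4; 5])%N.
Definition cycle5_6 : seq nat := ([:: 1; 2; 3; 4; 0; 5])%N.
Definition swap45 : seq nat := ([:: 0; 1; 2; 3; 5; 4])%N.

Lemma alt_list_check6 : alt_list_check 6.
Proof. by vm_compute. Qed.

Lemma automorphism_check6 : automorphism_check 6 outer_images.
Proof. by vm_compute. Qed.

Lemma cycles_mem6 : (cycle3_6 \in alt_list 6) && (cycle5_6 \in alt_list 6).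
Proof. by vm_compute. Qed.

Lemma cycle5_6_moved : nonconjugate 6 cycle5_6 (lmul (linv swap45) (lmul cycle5_6 swap45)).
Proof. by vm_compute. Qed.

Lemma cycle3_6_moved : nonconjugate 6 cycle3_6 (image 6 outer_images cycle3_6).
Proof. by vm_compute. Qed.

Lemma cycle5_6_fixed : image 6 outer_images cycle5_6 = cycle5_6.
Proof. by vm_compute. Qed.

(** The transposition [swap45] is disjoint from the 3-cycle, so conjugation fixes the latter but
    moves the class of the 5-cycle. The outer automorphism fixes the 5-cycle and sends the 3-cycle
    to a product of two 3-cycles. *)
Lemma Alt6_five_theories : 5 <= num_supercharacter_theories 'Alt_('I_6).
Proof.
have [f [injf fA] fE] :=
  @automorphism_of_table 6 outer_images isT alt_list_check6 automorphism_check6.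
have [b cb bE] := compatible_automorphism injf fA.
have [t tE] : exists t : {perm 'I_6}, code t = swap45 by apply: codeP.
have [a ca aE] := compatible_conj t.
have [u [v [Au Av u1 v1 ouv]]] := @Alt_orders_2_3 6 isT.
have /andP[Ly Lx] := cycles_mem6.
have [Ax xE] := @decode_alt 6 isT alt_list_check6 _ Lx.
have [Ay yE] := @decode_alt 6 isT alt_list_check6 _ Ly.
move: (decode 6 cycle5_6) (decode 6 cycle3_6) Ax xE Ay yE => x y Ax xE Ay yE.
have nc := @nonconjugateP 6 isT alt_list_check6.
apply: (five_supercharacter_theories ca cb Ax Ay _ _ _ _ Au Av u1 v1 ouv).
- rewrite aE // => /class_eqP; apply/negP/nc.
  by rewrite conjgE !codeM codeV xE tE; apply: cycle5_6_moved.
- rewrite aE //; congr (_ ^: _); apply: (@code_inj 6).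
  by rewrite conjgE !codeM codeV yE tE.
- rewrite bE // => /class_eqP; apply/negP/nc.
  by rewrite fE // yE; apply: cycle3_6_moved.
rewrite bE //; congr (_ ^: _); apply: (@code_inj 6).
by rewrite fE // xE; apply: cycle5_6_fixed.
Qed.

(** * Upper bounds for [A_3], [A_5], [A_7] and the final count *)

Definition reps3 : seq (seq nat) :=
  ([:: [:: 0; 1; 2]; [:: 1; 2; 0]; [:: 2; 0; 1]])%N.
(** The identity comes first, as [class_check] requires, and both classes of 5-cycles are
    represented. *)
Definition reps5 : seq (seq nat) :=
  ([:: [:: 0; 1; 2; 3; 4]; [:: 1; 4; 2; 3; 0]; [:: 4; 3; 2; 1; 0];
       [:: 1; 3; 0; 4; 2]; [:: 3; 4; 0; 1; 2]])%N.
Definition reps7 : seq (seq nat) :=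
  ([:: [:: 0; 1; 2; 3; 4; 5; 6]; [:: 1; 6; 2; 3; 4; 5; 0]; [:: 6; 5; 2; 3; 4; 1; 0];
       [:: 1; 5; 0; 3; 4; 6; 2]; [:: 5; 4; 0; 3; 1; 6; 2]; [:: 6; 4; 0; 3; 5; 1; 2];
       [:: 1; 4; 6; 0; 5; 2; 3]; [:: 1; 4; 0; 6; 5; 3; 2]; [:: 4; 3; 6; 1; 5; 0; 2]])%N.

Definition upper_check n reps k :=
  [&& 1 < n, alt_list_check n, class_check n reps & size (schur_partitions n reps) == k].

Lemma upper_checkP n reps k :
  upper_check n reps k -> num_supercharacter_theories 'Alt_('I_n) <= k.
Proof.
by case/and4P=> n1 altC classC /eqP <-; apply: num_supercharacter_theories_le.
Qed.

Lemma upper_check3 : upper_check 3 reps3 2. Proof. by vm_compute. Qed.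
Lemma upper_check5 : upper_check 5 reps5 3. Proof. by vm_compute. Qed.
Lemma upper_check7 : upper_check 7 reps7 3. Proof. by vm_compute. Qed.

(** For odd [n] an [n]-cycle commutes with even permutations only, so a transposition moves its
    class. *)
Lemma Alt_odd_three_theories n : 3 < n -> odd n ->
  3 <= num_supercharacter_theories 'Alt_('I_n).
Proof.
move=> n_gt3 odd_n; have n_gt0 : 0 < n by lia.
(* Only the [n]-cycle is wanted: no block is reversed and [k = 1]. *)
have [|||| g [h [cg _ _]]] := @block_cycles n [:: n] pred0 1; rewrite /= ?addn0 ?odd_n //.
have n_gt1 : 1 < n by lia.
apply: (@Alt_three_theories n g (tperm (Ordinal n_gt0) (Ordinal n_gt1)) n_gt3).
  by rewrite Alt_even cg.
by rewrite (conj_Alt_class _ cg) odd_tperm.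
Qed.

(** The group is trivial for [n] below 3 and not simple for [n = 4]. *)
Lemma simple_AltE n : simple 'Alt_('I_n) -> n = 3 \/ 4 < n.
Proof.
move=> simA; case: (ltngtP n 3) => [n_lt3 | n_gt3 | ->]; last by left.
  have := simA; rewrite trivial_Alt_2 ?card_ord; last by lia.
  by case/simpleP; rewrite eqxx.
right; rewrite ltn_neqAle n_gt3 andbT; apply/eqP=> n4.
by have := @not_simple_Alt_4 'I_n; rewrite card_ord simA => /(_ (esym n4)).
Qed.

Theorem theorem3p3 :
  (forall n : nat, 0 < n -> simple 'Alt_('I_n) ->
     (num_supercharacter_theories 'Alt_('I_n) = 3 <-> n = 5 \/ n = 7)) /\
  ~ (exists n : nat, [/\ 0 < n, simple 'Alt_('I_n)
       & num_supercharacter_theories 'Alt_('I_n) = 4]).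
Proof.
(* [A_3] lies below the range of the lower bounds and has at most two theories. *)
have le3 := upper_checkP upper_check3.
have eq3 n : n = 5 \/ n = 7 -> num_supercharacter_theories 'Alt_('I_n) = 3.
  case=> ->; apply/eqP; rewrite eqn_leq Alt_odd_three_theories // andbT.
    exact: upper_checkP upper_check5.
  exact: upper_checkP upper_check7.
have ge5 n : simple 'Alt_('I_n) -> n <> 5 -> n <> 7 ->
    n = 3 \/ 5 <= num_supercharacter_theories 'Alt_('I_n).
  case/simple_AltE => [-> | n_gt4 n5 n7]; [by left | right].
  have [-> | n6] := eqVneq n 6; first exact: Alt6_five_theories.
  by apply: Alt_ge8_theories; lia.
have not_3_4 n : simple 'Alt_('I_n) -> n <> 5 -> n <> 7 ->
    num_supercharacter_theories 'Alt_('I_n) <> 3 /\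
    num_supercharacter_theories 'Alt_('I_n) <> 4.
  move=> simA n5 n7; case: (ge5 n simA n5 n7) => [-> | ]; last by lia.
  by move: le3; lia.
split=> [n _ simA | [n [_ simA num4]]].
  split=> [num3 | /eq3 //].
  have [-> | /eqP n5] := eqVneq n 5; first by left.
  have [-> | /eqP n7] := eqVneq n 7; first by right.
  by case: (not_3_4 n simA n5 n7).
have [n5 | /eqP n5] := eqVneq n 5; first by rewrite eq3 in num4; last by left.
have [n7 | /eqP n7] := eqVneq n 7; first by rewrite eq3 in num4; last by right.
by case: (not_3_4 n simA n5 n7).
Qed.
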